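(* Let $T,\varepsilon,\kappa>0$, $|\rho|<1$, $\mu_1,\mu_2\in\mathbb{R}$, $x^*\ge0$, $\gamma\ge0$ with $\gamma\neq1$, and let $U:\mathcal{D}\to\mathbb{R}$ be a HARA utility function as described in the context. Assume $T<T^*(\gamma)$. Then the solution of the Hamilton-Jacobi-Bellman terminal value problem on $[0,T]\times\mathcal{D}\times\mathbb{R}$ $$\begin{cases} v_t+\Big(\mu_1-\mu_2-\frac{\kappa z}{T-t+\varepsilon}\Big)v_z+(1-\rho)v_{zz}+\sup_{\boldsymbol{\pi}\in\mathbb{R}^2}\mathcal{L}_{\boldsymbol{\pi}}v=0,\\ v(T,x,z)=U(x),\end{cases}$$ is $$v(t,x,z)=U(x)\exp\Big(f(t)+g(t)z+\tfrac12h(t)z^2\Big),\qquad (t,x,z)\in[0,T]\times\mathcal{D}\times\mathbb{R},$$ where $h$ is the solution on $[0,T]$ of the Riccati equation $$-h'(t)=2(1-\rho)\gamma h^2(t)-\frac{2\gamma\kappa}{T+\varepsilon-t}h(t)-\frac{(1-\gamma)\kappa^2}{(1-\rho^2)(T+\varepsilon-t)^2},\qquad h(T)=0$$ (given explicitly in the context), $g$ is given by $$g'(t)+\gamma\Big(2(1-\rho)h(t)-\frac{\kappa}{T+\varepsilon-t}\Big)g(t)=\frac{\kappa(1-\gamma)(\mu_2-\rho\mu_1)}{(1-\rho^2)(T+\varepsilon-t)}-\gamma(\mu_1-\mu_2)h(t),\qquad g(T)=0,$$ and $$f(t)=\int_t^T\Big[(1-\rho)\gamma g^2(u)+\gamm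a(\mu_1-\mu_2)g(u)+(1-\rho)h(u)\Big]du-\frac{(1-\gamma)(\mu_1^2+\mu_2^2-2\rho\mu_1\mu_2)(T-t)}{2(1-\rho^2)}.$$
   Context: Domain: $\mathcal{D}=\{x\in\mathbb{R}:x>x^*\}$ if $\gamma>0$ and $\mathcal{D}=\mathbb{R}$ if $\gamma=0$. Utility: $U:\mathcal{D}\to\mathbb{R}$ is a (smooth, strictly increasing, strictly concave) HARA utility function whose risk tolerance is $\delta(x):=-\frac{U'(x)}{U''(x)}=\gamma(x-x^* )$ if $\gamma>0$, and $\delta(x)=\delta_0>0$ (a constant) if $\gamma=0$; it is normalized so that, for $\gamma\ne1$, $\frac{U(x)}{U'(x)}=\frac{\delta(x)}{\gamma-1}$ on $\mathcal{D}$ (so $=\frac{\gamma}{\gamma-1}(x-x^* )$ if $\gamma>0$, and $=-\delta_0$ if $\gamma=0$). Operator: for $\boldsymbol{\pi}=(\pi_1,\pi_2)\in\mathbb{R}^2$, $$\mathcal{L}_{\boldsymbol{\pi}}\varphi:=\Big(\mu_1\pi_1+\Big(\mu_2+\frac{\kappa z}{T-t+\varepsilon}\Big)\pi_2\Big)\varphi_x+\tfrac12(\pi_1^2+\pi_2^2+2\rho\pi_1\pi_2)\varphi_{xx}+(1-\rho)(\pi_1-\pi_2)\varphi_{xz}.$$ Constants: $$\overline{\gamma}:=\frac{\sqrt{2\kappa^2+(1-2\kappa)(1+\rho)}}{\sqrt2\,\kappa(1-\rho)}-\frac{1-2\kappa+\rho}{2\kappa(1-\rho)}\ \ (\ge1),\qquad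 \Delta=\Delta(\gamma):=\frac{\rho-1}{\rho+1}\kappa^2\gamma^2+\Big(\frac{2\kappa}{1+\rho}-1\Big)\kappa\gamma+\frac14.$$ Escape time $T^*(\gamma)\in(0,+\infty]$: (i) if $\gamma>\overline\gamma$, $T^*(\gamma)=\varepsilon\Big[\exp\Big(\frac{\pi}{2\sqrt{-\Delta}}-\frac{1}{\sqrt{-\Delta}}\arctan\Big(\frac{1-2\gamma\kappa}{2\sqrt{-\Delta}}\Big)\Big)-1\Big]$ (here $\pi$ is the number pi); (ii) if $\gamma=\overline\gamma$ and $0<\kappa<\frac12$, $T^*(\gamma)=\varepsilon\Big[\exp\Big(\frac{2}{1-2\gamma\kappa}\Big)-1\Big]$; (iii) if $\gamma\in(1,\overline\gamma)$ and $0<\kappa<\frac12$, $T^*(\gamma)=\varepsilon\Big[\Big(\frac{\frac12-\gamma\kappa+\sqrt\Delta}{\frac12-\gamma\kappa-\sqrt\Delta}\Big)^{\frac{1}{2\sqrt\Delta}}-1\Big]$; (iv) $T^*(\gamma)=+\infty$ for all other $\gamma$. Explicit form of $h$ when $T<T^*(\gamma)$: if $\gamma>\overline\gamma$, $h(t)=\dfrac{\sqrt{-\Delta}\tan\big[\sqrt{-\Delta}\log(1+\frac{T-t}{\varepsilon})+\arctan(\frac{1-2\gamma\kappa}{2\sqrt{-\Delta}})\big]+\gamma\kappa-\frac12}{2\gamma(1-\rho)(T-t+\varepsilon)}$; if $\gamma=0$, $h(t)=-\frac{\kappa^2}{1-\rho^2}\big(\frac1\varepsilon-\frac{1}{T-t+\varepsilon}\big)$;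 if $\gamma=\overline\gamma$, $h(t)=\dfrac{\log(1+\frac{T-t}{\varepsilon})}{1-(\frac12-\gamma\kappa)\log(1+\frac{T-t}{\varepsilon})}\cdot\dfrac{(\frac12-\gamma\kappa)^2}{2\gamma(1-\rho)(T-t+\varepsilon)}$; if $0<\gamma<\overline\gamma$, $h(t)=\dfrac{(1+\frac{T-t}{\varepsilon})^{2\sqrt\Delta}-1}{(\sqrt\Delta-\frac12+\gamma\kappa)(1+\frac{T-t}{\varepsilon})^{2\sqrt\Delta}+\sqrt\Delta+\frac12-\gamma\kappa}\cdot\dfrac{\kappa^2(\gamma-1)}{(1-\rho^2)(T-t+\varepsilon)}$. *)

(* Defs.v *)
From Stdlib Require Import Reals.
From Coquelicot Require Import Coquelicot.
Open Scope R_scope.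

Definition wealth_domain (gamma xstar x : R) : Prop := gamma = 0 \/ xstar < x.

(** [delta0] is used only when [gamma = 0]. *)
Definition risk_tolerance (gamma xstar delta0 x : R) : R :=
  if Req_EM_T gamma 0 then delta0 else gamma * (x - xstar).

(** [U] is constrained on the (open) wealth domain only.  The condition
    [Derive_n U 2 x <> 0] makes the quotient in the risk tolerance meaningful,
    Stdlib's [/ 0] being an unspecified real. *)
Definition hara_utility (gamma xstar delta0 : R) (U : R -> R) : Prop :=
  let D := wealth_domain gamma xstar in
  let delta := risk_tolerance gamma xstar delta0 in
  (forall n x, D x -> ex_derive_n U n x) /\
  (forall x y, D x -> D y -> x < y -> U x < U y) /\
  (forall x y l, D x -> D y -> x <> y -> 0 < l < 1 ->
     l * U x + (1 - l) * U y < U (l * x + (1 - l) * y)) /\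
  (forall x, D x -> Derive_n U 2 x <> 0 /\
     - (Derive U x / Derive_n U 2 x) = delta x) /\
  (gamma <> 1 -> forall x, D x -> U x / Derive U x = delta x / (gamma - 1)).

Definition gamma_bar (kappa rho : R) : R :=
  sqrt (2 * kappa ^ 2 + (1 - 2 * kappa) * (1 + rho))
    / (sqrt 2 * kappa * (1 - rho))
  - (1 - 2 * kappa + rho) / (2 * kappa * (1 - rho)).

Definition Delta (kappa rho gamma : R) : R :=
  (rho - 1) / (rho + 1) * kappa ^ 2 * gamma ^ 2
  + (2 * kappa / (1 + rho) - 1) * kappa * gamma + 1 / 4.

(** In the [Rpower] branch [gamma * kappa < 1 / 2] and
    [0 < sqrt D < 1 / 2 - gamma * kappa], so the base is greater than 1. *)
Definition escape_time (eps kappa rho gamma : R) : Rbar :=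
  let gb := gamma_bar kappa rho in
  let D := Delta kappa rho gamma in
  if Rlt_dec gb gamma then
    Finite (eps * (exp (PI / (2 * sqrt (- D))
      - 1 / sqrt (- D) * atan ((1 - 2 * gamma * kappa) / (2 * sqrt (- D)))) - 1))
  else if Rlt_dec kappa (1 / 2) then
    if Req_EM_T gamma gb then
      Finite (eps * (exp (2 / (1 - 2 * gamma * kappa)) - 1))
    else if Rlt_dec 1 gamma then
      Finite (eps * (Rpower ((1 / 2 - gamma * kappa + sqrt D)
                             / (1 / 2 - gamma * kappa - sqrt D))
                            (1 / (2 * sqrt D)) - 1))
    else p_infty
  else p_infty.

(** Derivatives in time are relative to [[0, T]], hence one-sided at the
    endpoints. *)
Definition time_interval (T t : R) : Prop := 0 <= t <= T.

Definition time_derivative (T : R) (k dk : R -> R) (t : R) : Prop :=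
  D_in k dk (time_interval T) t.

Definition riccati (T eps kappa rho gamma : R) (h : R -> R) : Prop :=
  (exists dh : R -> R, forall t, time_interval T t ->
     time_derivative T h dh t /\
     - dh t = 2 * (1 - rho) * gamma * h t ^ 2
              - 2 * gamma * kappa / (T + eps - t) * h t
              - (1 - gamma) * kappa ^ 2
                / ((1 - rho ^ 2) * (T + eps - t) ^ 2)) /\
  h T = 0.

Definition linear_ode (T eps kappa rho mu1 mu2 gamma : R) (h g : R -> R) : Prop :=
  (exists dg : R -> R, forall t, time_interval T t ->
     time_derivative T g dg t /\
     dg t + gamma * (2 * (1 - rho) * h t - kappa / (T + eps - t)) * g t
     = kappa * (1 - gamma) * (mu2 - rho * mu1)
         / ((1 - rho ^ 2) * (T + eps - t))
       - gamma * (mu1 - mu2) * h t) /\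
  g T = 0.

Definition unique_on (T : R) (P : (R -> R) -> Prop) (k : R -> R) : Prop :=
  P k /\ forall k', P k' -> forall t, time_interval T t -> k' t = k t.

Definition h_explicit (T eps kappa rho gamma t : R) : R :=
  let gb := gamma_bar kappa rho in
  let D := Delta kappa rho gamma in
  let q := 1 + (T - t) / eps in
  if Rlt_dec gb gamma then
    (sqrt (- D) * tan (sqrt (- D) * ln q
                       + atan ((1 - 2 * gamma * kappa) / (2 * sqrt (- D))))
     + gamma * kappa - 1 / 2)
    / (2 * gamma * (1 - rho) * (T - t + eps))
  else if Req_EM_T gamma 0 then
    - (kappa ^ 2 / (1 - rho ^ 2)) * (1 / eps - 1 / (T - t + eps))
  else if Req_EM_T gamma gb then
    ln q / (1 - (1 / 2 - gamma * kappa) * ln q)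
    * ((1 / 2 - gamma * kappa) ^ 2 / (2 * gamma * (1 - rho) * (T - t + eps)))
  else
    (Rpower q (2 * sqrt D) - 1)
    / ((sqrt D - 1 / 2 + gamma * kappa) * Rpower q (2 * sqrt D)
       + sqrt D + 1 / 2 - gamma * kappa)
    * (kappa ^ 2 * (gamma - 1) / ((1 - rho ^ 2) * (T - t + eps))).

Definition f_integrand (rho mu1 mu2 gamma : R) (h g : R -> R) (u : R) : R :=
  (1 - rho) * gamma * g u ^ 2 + gamma * (mu1 - mu2) * g u + (1 - rho) * h u.

Definition f_coeff (T rho mu1 mu2 gamma : R) (h g : R -> R) (t : R) : R :=
  RInt (f_integrand rho mu1 mu2 gamma h g) t T
  - (1 - gamma) * (mu1 ^ 2 + mu2 ^ 2 - 2 * rho * mu1 * mu2) * (T - t)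
    / (2 * (1 - rho ^ 2)).

Definition exp_quadratic (U f g h : R -> R) (t x z : R) : R :=
  U x * exp (f t + g t * z + 1 / 2 * h t * z ^ 2).

(** [L_pi v] at [(t, z)] as a function of the values of [v_x], [v_xx], [v_xz]. *)
Definition generator (T eps kappa rho mu1 mu2 : R) (p : R * R)
    (t z vx vxx vxz : R) : R :=
  let (p1, p2) := p in
  (mu1 * p1 + (mu2 + kappa * z / (T - t + eps)) * p2) * vx
  + 1 / 2 * (p1 ^ 2 + p2 ^ 2 + 2 * rho * p1 * p2) * vxx
  + (1 - rho) * (p1 - p2) * vxz.

(** The supremum, a priori possibly infinite. *)
Definition sup_generator (T eps kappa rho mu1 mu2 t z vx vxx vxz : R) : Rbar :=
  Lub_Rbar (fun y => exists p : R * R,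
    y = generator T eps kappa rho mu1 mu2 p t z vx vxx vxz).

Definition jointly_continuous (T : R) (D : R -> Prop)
    (phi : R -> R -> R -> R) : Prop :=
  continuous_on
    (fun p : R * R * R => time_interval T (fst (fst p)) /\ D (snd (fst p)))
    (fun p : R * R * R => phi (fst (fst p)) (snd (fst p)) (snd p)).

(** [v] is a classical ([C^{1,2}]) solution on [[0,T] x D x R]. *)
Definition hjb_solution (T eps kappa rho mu1 mu2 : R) (D : R -> Prop)
    (U : R -> R) (v : R -> R -> R -> R) : Prop :=
  (exists vt vx vz vxx vxz vzz : R -> R -> R -> R,
     jointly_continuous T D v /\
     jointly_continuous T D vt /\
     jointly_continuous T D vx /\
     jointly_continuous T D vz /\
     jointly_continuous T D vxx /\
     jointly_continuous T D vxz /\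
     jointly_continuous T D vzz /\
     forall t x z, time_interval T t -> D x ->
       time_derivative T (fun s => v s x z) (fun s => vt s x z) t /\
       is_derive (fun y => v t y z) x (vx t x z) /\
       is_derive (fun w => v t x w) z (vz t x z) /\
       is_derive (fun y => vx t y z) x (vxx t x z) /\
       is_derive (fun w => vx t x w) z (vxz t x z) /\
       is_derive (fun w => vz t x w) z (vzz t x z) /\
       Rbar_plus
         (Finite (vt t x z
                  + (mu1 - mu2 - kappa * z / (T - t + eps)) * vz t x z
                  + (1 - rho) * vzz t x z))
         (sup_generator T eps kappa rho mu1 mu2 t z
            (vx t x z) (vxx t x z) (vxz t x z))
       = Finite 0) /\
  (forall x z, D x -> v T x z = U x).

(* Main.v *)
Require Import Defs.
From Stdlib Require Import Reals Lra.
From Coquelicot Require Import Coquelicot.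
Open Scope R_scope.

(** In the variables [s = ln (1 + (T-t)/eps)] and [y = (T-t+eps) h] the Riccati
    equation is autonomous, [y' = a y^2 + 2 c y + k] with [c = 1/2 - gamma kappa]
    and [c^2 - a k = Delta]; the four formulas for [h] are its solutions from
    [y = 0] according to the nature of the roots, and the escape time is the time
    at which they blow up.  For [v = U e^Q] the supremum over [pi] is that of a
    concave quadratic form, and the HARA identity [U'^2 / U'' = (1-gamma) U] turns
    the Hamilton-Jacobi-Bellman equation into [v] times a quadratic polynomial in
    [z], whose three coefficients are the ordinary differential equations for
    [f], [g], [h].  Conversely these equations hold for every solution of this
    form, and their terminal value problems have unique solutions by Gronwall. *)

(** * Functions on the time interval *)

(** The hypothesis [T < escape_time] controls the formula for h on [[0, T]] only: at negative times
    it may blow up. Two versions of h therefore coexist: the formula itself, differentiable at every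
    point of [[0, T]], and its composition with [clamp], merely continuous at the endpoints but
    continuous on the whole line. The first supplies derivatives, the second integrands and
    continuous coefficients.

    In the variable [s] the escape hypothesis only keeps the solution away from its pole: the
    argument of the tangent stays below pi/2, or a denominator stays nonzero. Which formula applies
    depends on the sign of [Delta], a quadratic in [gamma] whose only nonnegative root is
    [gamma_bar].

    In the converse direction the partial derivatives in [hjb_solution] are arbitrary witnesses;
    uniqueness of derivatives identifies the spatial ones, and the time derivative of the exponent
    comes from the logarithm of [v / U], which exists because [U] does not vanish. *)

(** Clamping time makes a function continuous on [[0, T]] continuous on [R], so
    that integrals need no domain bookkeeping. *)
Definition clamp (T t : R) : R := Rmax 0 (Rmin t T).

Lemma clamp_id (T t : R) : time_interval T t -> clamp T t = t.
Proof.
  intros [H0 HT]; unfold clamp.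
  rewrite Rmin_left by exact HT; apply Rmax_right; exact H0.
Qed.

Lemma clamp_in (T t : R) : 0 <= T -> time_interval T (clamp T t).
Proof.
  intros HT; unfold clamp, time_interval, Rmax, Rmin.
  repeat destruct Rle_dec; lra.
Qed.

Lemma clamp_lipschitz (T s t : R) : Rabs (clamp T s - clamp T t) <= Rabs (s - t).
Proof.
  unfold clamp, Rmax, Rmin.
  repeat destruct Rle_dec; split_Rabs; lra.
Qed.

Lemma continuous_clamp (T t : R) : continuous (clamp T) t.
Proof.
  apply filterlim_locally; intros e.
  exists e; intros s Hs.
  eapply Rle_lt_trans; [apply clamp_lipschitz | exact Hs].
Qed.

Lemma D_in_of_is_derive (f d : R -> R) (D : R -> Prop) (t : R) :
  is_derive f t (d t) -> D_in f d D t.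
Proof.
  intros H%is_derive_Reals e He.
  destruct (H e He) as [r Hr].
  exists r; split; [apply cond_pos |].
  intros s [[_ Hne] Hs]; simpl in *; unfold Rdist in *.
  replace (f s) with (f (t + (s - t))) by (f_equal; ring).
  apply Hr; [lra | exact Hs].
Qed.

Lemma is_derive_of_D_in (T t : R) (f d : R -> R) :
  0 < t < T -> D_in f d (time_interval T) t -> is_derive f t (d t).
Proof.
  intros [H0 HT] H; apply is_derive_Reals; intros e He.
  destruct (H e He) as [r [Hr Hd]].
  (* The increment must also keep [t + k] inside [[0, T]], since [D_in] only speaks of points of the
     domain. *)
  assert (Hm : 0 < Rmin r (Rmin t (T - t))) by (repeat apply Rmin_pos; lra).
  exists (mkposreal _ Hm); simpl; intros k Hk Hkm.
  pose proof (Rmin_l r (Rmin t (T - t))); pose proof (Rmin_r r (Rmin t (T - t))).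
  pose proof (Rmin_l t (T - t)); pose proof (Rmin_r t (T - t)).
  pose proof (Rle_abs k); pose proof (Rle_abs (- k)); rewrite Rabs_Ropp in *.
  specialize (Hd (t + k)); simpl in Hd; unfold Rdist in Hd.
  replace (t + k - t) with k in Hd by ring.
  apply Hd; repeat split; lra.
Qed.

Lemma D_in_congr (D : R -> Prop) (f1 f2 d1 d2 : R -> R) (t : R) :
  (forall s, D s -> f1 s = f2 s) -> D t -> d1 t = d2 t ->
  D_in f1 d1 D t -> D_in f2 d2 D t.
Proof.
  intros Hf Ht Hd H e He.
  destruct (H e He) as [r [Hr Hs]].
  exists r; split; [exact Hr |].
  intros s Hs'; rewrite <- Hd, <- (Hf t Ht), <- (Hf s (proj1 (proj1 Hs'))).
  exact (Hs s Hs').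
Qed.

Lemma continuous_clamp_of_D_in (T : R) (f d : R -> R) : 0 <= T ->
  (forall t, time_interval T t -> D_in f d (time_interval T) t) ->
  forall t, continuous (fun s => f (clamp T s)) t.
Proof.
  intros HT H t; apply filterlim_locally; intros e.
  destruct (cont_deriv _ _ _ _ (H _ (clamp_in T t HT)) e (cond_pos e))
    as [r [Hr Hs]].
  exists (mkposreal r Hr); intros s Hst.
  (* The limit in [cont_deriv] is over points distinct from the base point, so times with the same
     clamped value are treated apart. *)
  destruct (Req_dec (clamp T t) (clamp T s)) as [E | E].
  - rewrite E; apply ball_center.
  - apply (Hs (clamp T s)); split; [split; [exact (clamp_in T s HT) | exact E] |].
    eapply Rle_lt_trans; [apply clamp_lipschitz | exact Hst].
Qed.

Lemma bounded_of_D_in (T : R) (f d : R -> R) : 0 <= T ->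
  (forall t, time_interval T t -> D_in f d (time_interval T) t) ->
  exists M, forall t, time_interval T t -> Rabs (f t) <= M.
Proof.
  intros HT H.
  destruct (continuity_ab_maj (fun s => Rabs (f (clamp T s))) 0 T HT)
    as [m [Hm _]].
  - intros c _; apply continuity_pt_filterlim.
    apply (continuous_comp (fun s => f (clamp T s)) Rabs).
    + exact (continuous_clamp_of_D_in T f d HT H c).
    + apply continuous_Rabs.
  - exists (Rabs (f (clamp T m))); intros t Ht.
    specialize (Hm t Ht); simpl in Hm.
    rewrite (clamp_id T t Ht) in Hm; exact Hm.
Qed.

(** [d^2 e^(2Mt)] is nonnegative, nondecreasing, and vanishes at [T]. *)
Lemma backward_gronwall (T M : R) (d dd : R -> R) : 0 <= T ->
  (forall t, time_interval T t -> D_in d dd (time_interval T) t) ->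
  (forall t, time_interval T t -> Rabs (dd t) <= M * Rabs (d t)) ->
  d T = 0 -> forall t, time_interval T t -> d t = 0.
Proof.
  intros HT H HM HdT t Ht.
  (* Clamping gives continuity up to the endpoints, while two-sided derivatives exist only in the
     open interval: exactly what the mean value theorem asks. *)
  destruct (MVT_gen (fun s => d (clamp T s) ^ 2 * exp (2 * M * s)) t T
    (fun s => (2 * d s * dd s + 2 * M * d s ^ 2) * exp (2 * M * s)))
    as [c [Hc E]].
  - rewrite Rmin_left, Rmax_right by apply Ht; intros s Hs.
    assert (Hs' : 0 < s < T) by (destruct Ht; lra).
    apply (is_derive_ext_loc (fun s => d s ^ 2 * exp (2 * M * s))).
    + generalize (open_and _ _ (open_gt 0) (open_lt T) s Hs').
      apply filter_imp; intros u Hu; rewrite clamp_id; [reflexivity |].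
      unfold time_interval; lra.
    + assert (Hd : is_derive d s (dd s)).
      { apply (is_derive_of_D_in T); [exact Hs' | apply H; unfold time_interval; lra]. }
      auto_derive; [now exists (dd s) |].
      rewrite (is_derive_unique (fun u : R => d u) _ _ Hd); ring.
  - intros s _; apply continuity_pt_filterlim.
    apply (continuous_mult (fun s => d (clamp T s) ^ 2) (fun s => exp (2 * M * s))).
    + apply (continuous_comp (fun s => d (clamp T s)) (fun y => y ^ 2)).
      * exact (continuous_clamp_of_D_in T d dd HT H s).
      * apply (ex_derive_continuous (fun y : R => y ^ 2)); auto_derive; exact I.
    + apply (ex_derive_continuous (fun s : R => exp (2 * M * s))); auto_derive; exact I.
  - rewrite Rmin_left, Rmax_right in Hc by apply Ht.
    assert (Hc' : time_interval T c) by (unfold time_interval in *; lra).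
    rewrite (clamp_id T t Ht), (clamp_id T T), HdT in E
      by (unfold time_interval; lra).
    assert (Hpos : 0 <= 2 * d c * dd c + 2 * M * d c ^ 2).
    { specialize (HM c Hc').
      pose proof (Rle_abs (- (d c * dd c))) as H1.
      rewrite Rabs_Ropp, Rabs_mult in H1.
      pose proof (Rmult_le_compat_l _ _ _ (Rabs_pos (d c)) HM) as H2.
      assert (H3 : Rabs (d c) * Rabs (d c) = d c ^ 2)
        by (rewrite <- Rabs_mult, Rabs_pos_eq; nra).
      replace (Rabs (d c) * (M * Rabs (d c))) with (M * d c ^ 2) in H2
        by (rewrite <- H3; ring).
      lra. }
    pose proof (exp_pos (2 * M * c)) as P1; pose proof (exp_pos (2 * M * t)) as P2.
    assert (P3 : 0 <= (2 * d c * dd c + 2 * M * d c ^ 2) * exp (2 * M * c) * (T - t)).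
    { apply Rmult_le_pos; [apply Rmult_le_pos; lra | destruct Ht; lra]. }
    rewrite <- E in P3.
    assert (d t ^ 2 * exp (2 * M * t) <= 0) by lra.
    destruct (Req_dec (d t) 0) as [Z | Z]; [exact Z | exfalso].
    assert (0 < d t ^ 2) by nra.
    nra.
Qed.

(** * Integrals with a variable limit and linear equations on the line *)

Lemma is_derive_RInt_upper (f : R -> R) (a t : R) :
  (forall s, continuous f s) -> is_derive (fun s => RInt f a s) t (f t).
Proof.
  intros H; apply (is_derive_RInt f _ a); [| apply H].
  apply filter_forall; intros s; apply (RInt_correct (V := R_CompleteNormedModule)).
  apply (ex_RInt_continuous (V := R_CompleteNormedModule)); intros; apply H.
Qed.

(** Variation of constants: [exp A] is the integrating factor, and basing both integrals at [T]
    makes the terminal value zero. *)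
Lemma linear_ode_exists (T : R) (a r : R -> R) :
  (forall t, continuous a t) -> (forall t, continuous r t) ->
  exists g : R -> R, g T = 0 /\ forall t, is_derive g t (r t - a t * g t).
Proof.
  intros Ha Hr.
  set (A := fun t => RInt a T t).
  set (B := fun t => RInt (fun s => r s * exp (A s)) T t).
  assert (HA : forall t, is_derive A t (a t)).
  { intros t; apply is_derive_RInt_upper; exact Ha. }
  assert (HB : forall t, is_derive B t (r t * exp (A t))).
  { intros t; apply (is_derive_RInt_upper (fun s => r s * exp (A s))); intros s.
    apply (continuous_mult r (fun s => exp (A s))); [apply Hr |].
    apply (continuous_comp A exp).
    - apply (ex_derive_continuous A); exists (a s); apply HA.
    - apply continuous_exp. }
  exists (fun t => exp (- A t) * B t); split.
  - unfold B; rewrite RInt_point; apply Rmult_0_r.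
  - intros t; auto_derive.
    + split; [exists (a t); apply HA | split; [exists (r t * exp (A t)); apply HB | exact I]].
    + rewrite (is_derive_unique (fun u : R => A u) _ _ (HA t)), (is_derive_unique (fun u : R => B u) _ _ (HB t)).
      rewrite exp_Ropp; field; apply Rgt_not_eq, exp_pos.
Qed.

(** * The autonomous Riccati equation and the escape time *)

(** The derivative of [s] in [t] is [- 1 / (T - t + eps)]. Differentiating the denominator of [h]
    contributes a further [y], whence the linear coefficient [1 - b] in place of [- b]. *)
Lemma riccati_of_autonomous (T eps a b k : R) (y : R -> R) (t : R) :
  0 < eps -> t <= T ->
  let s := ln (1 + (T - t) / eps) in
  is_derive y s (a * y s ^ 2 + (1 - b) * y s - k) ->
  let h := fun t => y (ln (1 + (T - t) / eps)) / (T - t + eps) in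
  is_derive h t (- (a * h t ^ 2 - b / (T + eps - t) * h t - k / (T + eps - t) ^ 2)).
Proof.
  intros He Ht s Hy h.
  assert (Hq : 0 < 1 + (T - t) / eps).
  { replace (1 + (T - t) / eps) with ((T - t + eps) / eps) by (field; lra).
    apply Rdiv_lt_0_compat; lra. }
  unfold h; auto_derive.
  - repeat split; try lra.
    + eexists; exact Hy.
  - change (ln (1 + (T + - t) * / eps)) with s.
    rewrite (is_derive_unique (fun u : R => y u) _ _ Hy); fold s.
    field; repeat split; lra.
Qed.

(** * The sign of the discriminant [Delta] *)

Lemma Delta_square (kappa rho gamma : R) : -1 < rho ->
  Defs.Delta kappa rho gamma
  = (1 / 2 - gamma * kappa) ^ 2 + 2 * gamma * (1 - gamma) * kappa ^ 2 / (1 + rho).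
Proof. intros H; unfold Defs.Delta; field; lra. Qed.

(** As a function of [gamma], [Delta] is a concave quadratic with value 1/4 at 0, so its roots have
    opposite signs; [gamma_bar] is the positive one. *)
Lemma Delta_factor (kappa rho : R) : 0 < kappa -> -1 < rho < 1 ->
  exists a g, 0 < a /\ g < 0 /\ forall gamma,
  Defs.Delta kappa rho gamma = a * (gamma_bar kappa rho - gamma) * (gamma - g).
Proof.
  intros Hk Hr.
  set (S := 2 * kappa ^ 2 + (1 - 2 * kappa) * (1 + rho)).
  assert (HS : 2 * S = (2 * kappa - 1 - rho) ^ 2 + (1 - rho ^ 2)) by (unfold S; ring).
  assert (Hr2 : 0 < 1 - rho ^ 2) by nra.
  assert (HS0 : 0 < S) by (pose proof (pow2_ge_0 (2 * kappa - 1 - rho)); lra).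
  set (R := sqrt (2 * S)).
  assert (HR : R * R = 2 * S) by (apply sqrt_sqrt; lra).
  assert (HRp : 0 < R) by (apply sqrt_lt_R0; lra).
  assert (H2 : 0 < sqrt 2) by (apply sqrt_lt_R0; lra).
  assert (H22 : sqrt 2 * sqrt 2 = 2) by (apply sqrt_sqrt; lra).
  assert (HRs : R = sqrt 2 * sqrt S) by (apply sqrt_mult; lra).
  assert (Hgb : gamma_bar kappa rho = (R + (2 * kappa - 1 - rho)) / (2 * kappa * (1 - rho))).
  { unfold gamma_bar; fold S; rewrite HRs.
    replace (sqrt S / (sqrt 2 * kappa * (1 - rho)))
      with (sqrt 2 * sqrt S / ((sqrt 2 * sqrt 2) * kappa * (1 - rho)))
      by (field; repeat split; lra).
    rewrite H22; field; lra. }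
  exists ((1 - rho) / (1 + rho) * kappa ^ 2),
    ((- R + (2 * kappa - 1 - rho)) / (2 * kappa * (1 - rho))).
  repeat split.
  - apply Rmult_lt_0_compat; [apply Rdiv_lt_0_compat; lra | nra].
  - assert (2 * kappa - 1 - rho < R) by (rewrite HS in HR; nra).
    assert (0 < 2 * kappa * (1 - rho)) by nra.
    apply Rmult_lt_reg_r with (2 * kappa * (1 - rho)); [lra |].
    unfold Rdiv; rewrite Rmult_assoc, Rinv_l by lra; lra.
  - intros gamma; rewrite Hgb; unfold Defs.Delta.
    apply Rminus_diag_uniq.
    (* Expanded, the two sides differ by a multiple of [2 * S - R * R], which vanishes. *)
    transitivity ((2 * S - R * R) / (4 * (1 - rho) * (1 + rho))).
    + unfold S; field; repeat split; lra.
    + rewrite HR; unfold Rdiv; ring.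
Qed.

Lemma Delta_pos (kappa rho gamma : R) : 0 < kappa -> -1 < rho < 1 ->
  0 <= gamma -> gamma < gamma_bar kappa rho -> 0 < Defs.Delta kappa rho gamma.
Proof.
  intros Hk Hr Hg Hgb.
  destruct (Delta_factor kappa rho Hk Hr) as (a & g & Ha & Hgn & E); rewrite E.
  repeat apply Rmult_lt_0_compat; lra.
Qed.

Lemma Delta_neg (kappa rho gamma : R) : 0 < kappa -> -1 < rho < 1 ->
  0 <= gamma -> gamma_bar kappa rho < gamma -> Defs.Delta kappa rho gamma < 0.
Proof.
  intros Hk Hr Hg Hgb.
  destruct (Delta_factor kappa rho Hk Hr) as (a & g & Ha & Hgn & E); rewrite E.
  assert (0 < a * (gamma - gamma_bar kappa rho) * (gamma - g))
    by (repeat apply Rmult_lt_0_compat; lra).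
  lra.
Qed.

Lemma Delta_gamma_bar (kappa rho : R) : 0 < kappa -> -1 < rho < 1 ->
  Defs.Delta kappa rho (gamma_bar kappa rho) = 0.
Proof.
  intros Hk Hr.
  destruct (Delta_factor kappa rho Hk Hr) as (a & g & _ & _ & E); rewrite E; ring.
Qed.

(** At [gamma = 1] the discriminant is the square of [1 / 2 - kappa], hence not negative, so 1
    cannot lie beyond the positive root. *)
Lemma gamma_bar_ge_1 (kappa rho : R) : 0 < kappa -> -1 < rho < 1 ->
  1 <= gamma_bar kappa rho.
Proof.
  intros Hk Hr; apply Rnot_lt_le; intros H.
  assert (N := Delta_neg kappa rho 1 Hk Hr ltac:(lra) H).
  rewrite Delta_square in N by lra.
  replace (2 * 1 * (1 - 1) * kappa ^ 2 / (1 + rho)) with 0 in N by (field; lra).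
  pose proof (pow2_ge_0 (1 / 2 - 1 * kappa)); lra.
Qed.

(** [Delta] is negative at [1 / (2 * kappa)] when this exceeds 1. *)
Lemma gamma_kappa_lt_half (kappa rho gamma : R) : 0 < kappa < 1 / 2 -> -1 < rho < 1 ->
  gamma <= gamma_bar kappa rho -> gamma * kappa < 1 / 2.
Proof.
  intros Hk Hr Hg.
  assert (H1 : 1 < / (2 * kappa)).
  { rewrite <- Rinv_1 at 1; apply Rinv_lt_contravar; lra. }
  assert (N : Defs.Delta kappa rho (/ (2 * kappa)) < 0).
  { rewrite Delta_square by lra.
    replace (1 / 2 - / (2 * kappa) * kappa) with 0 by (field; lra).
    assert (0 < 2 * / (2 * kappa) * (/ (2 * kappa) - 1) * kappa ^ 2 / (1 + rho)).
    { apply Rdiv_lt_0_compat; [| lra].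
      apply Rmult_lt_0_compat; [apply Rmult_lt_0_compat; lra | nra]. }
    lra. }
  assert (L : gamma_bar kappa rho < / (2 * kappa)).
  { destruct (Delta_factor kappa rho (proj1 Hk) Hr) as (a & g & Ha & Hgn & E).
    rewrite E in N; apply Rnot_le_lt; intros C.
    assert (0 <= a * (gamma_bar kappa rho - / (2 * kappa)) * (/ (2 * kappa) - g))
      by (repeat apply Rmult_le_pos; lra).
    lra. }
  replace (1 / 2) with (/ (2 * kappa) * kappa) by (field; lra).
  apply Rmult_lt_compat_r; lra.
Qed.

(** Every finite escape time has the form [eps * (exp b - 1)], where [b] is the blow-up time in the
    variable [s]; this translates the hypothesis on [T] into a bound on [s]. *)
Lemma ln_time_ratio_lt (T eps t b : R) : 0 < eps -> 0 <= t <= T ->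
  T < eps * (exp b - 1) -> ln (1 + (T - t) / eps) < b.
Proof.
  intros He Ht H.
  assert (0 <= (T - t) / eps) by (apply Rle_mult_inv_pos; lra).
  rewrite <- (ln_exp b); apply ln_increasing; [lra |].
  apply Rmult_lt_reg_l with eps; [lra |].
  replace (eps * (1 + (T - t) / eps)) with (eps + (T - t)) by (field; lra).
  lra.
Qed.

Lemma ln_time_ratio_nonneg (T eps t : R) : 0 < eps -> t <= T ->
  0 <= ln (1 + (T - t) / eps).
Proof.
  intros He Ht.
  assert (0 <= (T - t) / eps) by (apply Rle_mult_inv_pos; lra).
  rewrite <- ln_1; apply ln_le; lra.
Qed.

(** * Closed-form solutions of the autonomous equation *)

Lemma autonomous_tan (w c a s : R) : a <> 0 ->
  - PI / 2 < w * s + atan (c / w) < PI / 2 ->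
  let y := fun s => (w * tan (w * s + atan (c / w)) - c) / a in
  is_derive y s (a * y s ^ 2 + 2 * c * y s + (w ^ 2 + c ^ 2) / a).
Proof.
  intros Ha Hs y.
  assert (Hc : cos (w * s + atan (c / w)) <> 0) by (apply Rgt_not_eq, cos_gt_0; lra).
  assert (D := is_derive_tan _ Hc).
  (* Completing the square, the equation is [a y' = (a y + c)^2 + w^2], and [tan' = tan^2 + 1]. *)
  unfold y; auto_derive; [eexists; exact D |].
  rewrite (is_derive_unique (fun u : R => tan u) _ _ D).
  field; exact Ha.
Qed.

(** Here [a y' = (a y + c)^2], so where [a y + c] is nonzero its inverse is affine in [s] with slope
    -1. *)
Lemma autonomous_double_root (c a s : R) : a <> 0 -> 1 - c * s <> 0 ->
  let y := fun s => s / (1 - c * s) * (c ^ 2 / a) in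
  is_derive y s (a * y s ^ 2 + 2 * c * y s + c ^ 2 / a).
Proof.
  intros Ha Hs y; unfold y; auto_derive; [exact Hs |].
  field; split; assumption.
Qed.

Lemma autonomous_linear (k s : R) :
  let y := fun s => k * (1 - exp s) in
  is_derive y s (y s - k).
Proof. intros y; unfold y; auto_derive; [exact I | ring]. Qed.

(** Partial fractions at the roots [(- c + w) / a] and [(- c - w) / a] give the cross-ratio of [y]
    growing like [exp (2 w s)]; the formula inverts this relation. *)
Lemma autonomous_real_roots (w c a k s : R) :
  a * k = c ^ 2 - w ^ 2 ->
  (w - c) * exp (s * (2 * w)) + w + c <> 0 ->
  let y := fun s =>
    (exp (s * (2 * w)) - 1) / ((w - c) * exp (s * (2 * w)) + w + c) * k in
  is_derive y s (a * y s ^ 2 + 2 * c * y s + k).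
Proof.
  intros Hk Hs y; unfold y; auto_derive; [exact Hs |].
  set (E := exp (s * (2 * w))) in *.
  replace (a * ((E - 1) / ((w - c) * E + w + c) * k) ^ 2)
    with ((a * k) * k * ((E - 1) / ((w - c) * E + w + c)) ^ 2) by (field; exact Hs).
  rewrite Hk; field; exact Hs.
Qed.

(** * The explicit formula solves the Riccati equation *)

Definition riccati_rate (T eps kappa rho gamma t k : R) : R :=
  - (2 * (1 - rho) * gamma * k ^ 2 - 2 * gamma * kappa / (T + eps - t) * k
     - (1 - gamma) * kappa ^ 2 / ((1 - rho ^ 2) * (T + eps - t) ^ 2)).

(** A two-sided derivative at [t = T] requires the identification with [y] on a neighbourhood, hence
    at all [s < T + eps], where the logarithm still has a positive argument. *)
Lemma h_explicit_derive_of_autonomous (T eps kappa rho gamma : R) (y : R -> R) (t : R) :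
  0 < eps -> t <= T -> -1 < rho < 1 ->
  (forall s, s < T + eps -> h_explicit T eps kappa rho gamma s
     = y (ln (1 + (T - s) / eps)) / (T - s + eps)) ->
  let s := ln (1 + (T - t) / eps) in
  is_derive y s (2 * (1 - rho) * gamma * y s ^ 2 + 2 * (1 / 2 - gamma * kappa) * y s
                 + (gamma - 1) * kappa ^ 2 / (1 - rho ^ 2)) ->
  is_derive (h_explicit T eps kappa rho gamma) t
    (riccati_rate T eps kappa rho gamma t (h_explicit T eps kappa rho gamma t)).
Proof.
  intros He Ht Hr Hy s Hd.
  assert (Hr2 : 0 < 1 - rho ^ 2) by nra.
  apply (is_derive_ext_loc (fun s => y (ln (1 + (T - s) / eps)) / (T - s + eps))).
  { assert (Hlt : t < T + eps) by lra.
    generalize (open_lt (T + eps) t Hlt); apply filter_imp.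
    intros u Hu; symmetry; apply Hy; exact Hu. }
  rewrite Hy by lra; unfold riccati_rate.
  replace ((1 - gamma) * kappa ^ 2 / ((1 - rho ^ 2) * (T + eps - t) ^ 2))
    with ((1 - gamma) * kappa ^ 2 / (1 - rho ^ 2) / (T + eps - t) ^ 2)
    by (field; split; lra).
  apply (riccati_of_autonomous T eps (2 * (1 - rho) * gamma) (2 * gamma * kappa)
           ((1 - gamma) * kappa ^ 2 / (1 - rho ^ 2))); [exact He | exact Ht |].
  fold s; match goal with |- is_derive _ _ ?l => match type of Hd with
    is_derive _ _ ?l' => replace l with l' by (field; lra) end end.
  exact Hd.
Qed.

(** For [c <= w] positivity holds at all times. For [w < c], comparing [w^2 = Delta] with [c^2]
    forces [1 < gamma], and then [0 < c] forces [kappa < 1 / 2]: this is exactly the power branch of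
    [escape_time], and the bound on [T] says that the exponential is below [(c + w) / (c - w)], the
    value at which the denominator vanishes. *)
Lemma real_roots_denominator_pos (T eps kappa rho gamma t : R) :
  0 < eps -> 0 < kappa -> -1 < rho < 1 -> 0 < gamma -> gamma <> 1 ->
  gamma < gamma_bar kappa rho ->
  Rbar_lt (Finite T) (escape_time eps kappa rho gamma) -> 0 <= t <= T ->
  let w := sqrt (Defs.Delta kappa rho gamma) in
  let c := 1 / 2 - gamma * kappa in
  0 < (w - c) * exp (ln (1 + (T - t) / eps) * (2 * w)) + w + c.
Proof.
  intros He Hk Hr Hg Hg1 Hgb Hesc Ht w c.
  assert (HD := Delta_pos kappa rho gamma Hk Hr (Rlt_le _ _ Hg) Hgb).
  assert (Hw : 0 < w) by (apply sqrt_lt_R0; exact HD).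
  assert (Hw2 : w * w = Defs.Delta kappa rho gamma) by (apply sqrt_sqrt; lra).
  rewrite Delta_square in Hw2 by lra; fold c in Hw2.
  set (s := ln (1 + (T - t) / eps)).
  assert (Hs : 0 <= s) by (apply ln_time_ratio_nonneg; lra).
  assert (HE : 1 <= exp (s * (2 * w))).
  { pose proof (exp_ineq1_le (s * (2 * w))).
    pose proof (Rmult_le_pos s (2 * w) Hs ltac:(lra)); lra. }
  destruct (Rle_lt_dec c w) as [Hcw | Hcw].
  { replace ((w - c) * exp (s * (2 * w)) + w + c)
      with ((w - c) * (exp (s * (2 * w)) - 1) + 2 * w) by ring.
    pose proof (Rmult_le_pos (w - c) (exp (s * (2 * w)) - 1) ltac:(lra) ltac:(lra)); lra. }
  assert (Hg2 : 1 < gamma).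
  { apply Rnot_le_lt; intros Hle.
    assert (0 <= 2 * gamma * (1 - gamma) * kappa ^ 2 / (1 + rho)).
    { apply Rle_mult_inv_pos; [| lra].
      apply Rmult_le_pos; [apply Rmult_le_pos; lra | apply pow2_ge_0]. }
    nra. }
  assert (Hk2 : kappa < 1 / 2) by (unfold c in *; nra).
  unfold escape_time in Hesc.
  destruct Rlt_dec as [H | _] in Hesc; [lra |].
  destruct Rlt_dec as [_ | H] in Hesc; [| lra].
  destruct Req_EM_T as [H | _] in Hesc; [lra |].
  destruct Rlt_dec as [_ | H] in Hesc; [| lra].
  fold w c in Hesc; unfold Rpower in Hesc; simpl in Hesc.
  apply ln_time_ratio_lt with (t := t) in Hesc; [| lra | lra]; fold s in Hesc.
  assert (HB : 0 < (c + w) / (c - w)) by (apply Rdiv_lt_0_compat; lra).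
  assert (L : s * (2 * w) < ln ((c + w) / (c - w))).
  { apply Rmult_lt_compat_r with (r := 2 * w) in Hesc; [| lra].
    replace (1 / (2 * w) * ln ((c + w) / (c - w)) * (2 * w))
      with (ln ((c + w) / (c - w))) in Hesc by (field; lra).
    exact Hesc. }
  apply exp_increasing in L; rewrite exp_ln in L by exact HB.
  apply Rmult_lt_compat_r with (r := c - w) in L; [| lra].
  replace ((c + w) / (c - w) * (c - w)) with (c + w) in L by (field; lra).
  lra.
Qed.

Lemma h_explicit_derive (T eps kappa rho gamma t : R) :
  0 < eps -> 0 < kappa -> -1 < rho < 1 -> 0 <= gamma -> gamma <> 1 ->
  Rbar_lt (Finite T) (escape_time eps kappa rho gamma) -> 0 <= t <= T ->
  is_derive (h_explicit T eps kappa rho gamma) t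
    (riccati_rate T eps kappa rho gamma t (h_explicit T eps kappa rho gamma t)).
Proof.
  intros He Hk Hr Hg0 Hg1 Hesc Ht.
  assert (Hr2 : 0 < 1 - rho ^ 2) by nra.
  pose proof (gamma_bar_ge_1 kappa rho Hk Hr) as Hgb1.
  assert (Hs0 : 0 <= ln (1 + (T - t) / eps)) by (apply ln_time_ratio_nonneg; lra).
  pose proof (Delta_square kappa rho gamma ltac:(lra)) as HDs.
  destruct (Rlt_dec (gamma_bar kappa rho) gamma) as [Hgt | Hle].
  - assert (HD := Delta_neg kappa rho gamma Hk Hr Hg0 Hgt).
    set (w := sqrt (- Defs.Delta kappa rho gamma)).
    assert (Hw : 0 < w) by (apply sqrt_lt_R0; lra).
    assert (Hw2 : w * w = - Defs.Delta kappa rho gamma) by (apply sqrt_sqrt; lra).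
    rewrite HDs in Hw2.
    assert (Hc : (1 - 2 * gamma * kappa) / (2 * w) = (1 / 2 - gamma * kappa) / w)
      by (field; lra).
    unfold escape_time in Hesc; destruct Rlt_dec as [_ | H] in Hesc; [| lra].
    fold w in Hesc; rewrite Hc in Hesc; simpl in Hesc.
    apply ln_time_ratio_lt with (t := t) in Hesc; [| lra | lra].
    apply (h_explicit_derive_of_autonomous _ _ _ _ _
      (fun s => (w * tan (w * s + atan ((1 / 2 - gamma * kappa) / w)) - (1 / 2 - gamma * kappa)) / (2 * (1 - rho) * gamma)));
      try assumption; try lra.
    + intros s Hs; unfold h_explicit.
      destruct Rlt_dec as [_ | H]; [| lra].
      fold w; rewrite Hc.
      simpl; field; repeat split; lra.
    + set (s := ln (1 + (T - t) / eps)) in *.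
      replace ((gamma - 1) * kappa ^ 2 / (1 - rho ^ 2))
        with ((w ^ 2 + (1 / 2 - gamma * kappa) ^ 2) / (2 * (1 - rho) * gamma)).
      (* This is [a k = c^2 - Delta] with [Delta = - w^2]. *)
      2:{ replace (w ^ 2) with (w * w) by ring; rewrite Hw2; field; repeat split; nra. }
      apply (autonomous_tan w (1 / 2 - gamma * kappa) (2 * (1 - rho) * gamma) s); [nra |].
      (* The lower bound holds because the phase starts at an arctangent and increases with [s]; the
         upper bound is the escape hypothesis multiplied by [w]. *)
      destruct (atan_bound ((1 / 2 - gamma * kappa) / w)) as [A1 A2].
      assert (0 <= w * s) by (apply Rmult_le_pos; lra).
      split; [lra |].
      apply Rmult_lt_compat_l with (r := w) in Hesc; [| lra].
      match type of Hesc with _ < ?r => replace r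
        with (PI / 2 - atan ((1 / 2 - gamma * kappa) / w)) in Hesc by (field; lra) end.
      lra.
  - destruct (Req_dec gamma 0) as [Hz | Hz].
    (* At [gamma = 0] the quadratic term vanishes and [2 c = 1], so the autonomous equation is
       linear. *)
    + apply (h_explicit_derive_of_autonomous _ _ _ _ _
      (fun s => kappa ^ 2 / (1 - rho ^ 2) * (1 - exp s)));
      try assumption; try lra.
      * intros s Hs; unfold h_explicit.
        destruct Rlt_dec as [H | _]; [lra |].
        destruct Req_EM_T as [_ | H]; [| lra].
        assert (0 < 1 + (T - s) / eps).
        { replace (1 + (T - s) / eps) with ((T - s + eps) / eps) by (field; lra).
          apply Rdiv_lt_0_compat; lra. }
        simpl; rewrite exp_ln by assumption; field; repeat split; nra.
      * subst gamma.
        match goal with |- is_derive _ ?s ?l => replace l with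
          (kappa ^ 2 / (1 - rho ^ 2) * (1 - exp s) - kappa ^ 2 / (1 - rho ^ 2))
          by (field; nra) end.
        apply (autonomous_linear (kappa ^ 2 / (1 - rho ^ 2))).
    + destruct (Req_dec gamma (gamma_bar kappa rho)) as [Heq | Hne].
      * set (c := 1 / 2 - gamma * kappa) in *.
        assert (HD := Delta_gamma_bar kappa rho Hk Hr); rewrite <- Heq, HDs in HD.
        apply (h_explicit_derive_of_autonomous _ _ _ _ _
      (fun s => s / (1 - c * s) * (c ^ 2 / (2 * (1 - rho) * gamma))));
      try assumption; try lra.
        -- intros s Hs; unfold h_explicit.
           destruct Rlt_dec as [H | _]; [lra |].
           destruct Req_EM_T as [H | _]; [lra |].
           destruct Req_EM_T as [_ | H]; [| lra].
           fold c.
           unfold Rdiv; simpl; rewrite !Rinv_mult; ring.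
        -- set (s := ln (1 + (T - t) / eps)) in *; fold c.
           replace ((gamma - 1) * kappa ^ 2 / (1 - rho ^ 2))
             with (c ^ 2 / (2 * (1 - rho) * gamma)).
           2:{ replace (c ^ 2) with (- (2 * gamma * (1 - gamma) * kappa ^ 2 / (1 + rho)))
                 by lra.
               field; repeat split; nra. }
           apply (autonomous_double_root c (2 * (1 - rho) * gamma) s); [nra |].
           (* The pole is at [s = 1 / c]. For [kappa < 1 / 2] one has [0 < c] and the escape time is
              this pole; otherwise [1 <= gamma] gives [c <= 0], and no pole is met for [0 <= s]. *)
           destruct (Rlt_dec kappa (1 / 2)) as [Hk2 | Hk2].
           ++ assert (Hgk := gamma_kappa_lt_half kappa rho gamma
                (conj Hk Hk2) Hr (Req_le _ _ Heq)).
              unfold escape_time in Hesc.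
              destruct Rlt_dec as [H | _] in Hesc; [lra |].
              destruct Rlt_dec as [_ | H] in Hesc; [| lra].
              destruct Req_EM_T as [_ | H] in Hesc; [| lra].
              simpl in Hesc; apply ln_time_ratio_lt with (t := t) in Hesc; [| lra | lra].
              fold s in Hesc.
              apply Rmult_lt_compat_l with (r := c) in Hesc; [| unfold c; lra].
              replace (c * (2 / (1 - 2 * gamma * kappa))) with 1 in Hesc
                by (unfold c; field; lra).
              lra.
           ++ assert (c <= 0) by (unfold c; nra).
              nra.
      * set (c := 1 / 2 - gamma * kappa) in *.
        assert (Hlt : gamma < gamma_bar kappa rho) by lra.
        assert (HD := Delta_pos kappa rho gamma Hk Hr Hg0 Hlt).
        assert (Hden := real_roots_denominator_pos T eps kappa rho gamma t
          He Hk Hr ltac:(lra) Hg1 Hlt Hesc Ht); cbv zeta in Hden; fold c in Hden.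
        set (w := sqrt (Defs.Delta kappa rho gamma)) in *.
        assert (Hw2 : w * w = Defs.Delta kappa rho gamma) by (apply sqrt_sqrt; lra).
        rewrite HDs in Hw2.
        apply (h_explicit_derive_of_autonomous _ _ _ _ _
      (fun s => (exp (s * (2 * w)) - 1) / ((w - c) * exp (s * (2 * w)) + w + c) * ((gamma - 1) * kappa ^ 2 / (1 - rho ^ 2))));
      try assumption; try lra.
        -- intros s Hs; unfold h_explicit.
           destruct Rlt_dec as [H | _]; [lra |].
           destruct Req_EM_T as [H | _]; [lra |].
           destruct Req_EM_T as [H | _]; [lra |].
           fold w; unfold Rpower.
           simpl; rewrite (Rmult_comm (2 * w)).
           replace ((w - 1 / 2 + gamma * kappa) * exp (ln (1 + (T - s) / eps) * (2 * w))
                    + w + 1 / 2 - gamma * kappa)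
             with ((w - c) * exp (ln (1 + (T - s) / eps) * (2 * w)) + w + c)
             by (unfold c; ring).
           unfold Rdiv; rewrite !Rinv_mult; ring.
        -- fold c.
           apply (autonomous_real_roots w c (2 * (1 - rho) * gamma)); [| lra].
           replace (w ^ 2) with (w * w) by ring; rewrite Hw2; fold c.
           field; nra.
Qed.

Lemma h_explicit_terminal (T eps kappa rho gamma : R) :
  0 < eps -> 0 < kappa -> -1 < rho < 1 -> 0 <= gamma ->
  h_explicit T eps kappa rho gamma T = 0.
Proof.
  intros He Hk Hr Hg; unfold h_explicit.
  replace (1 + (T - T) / eps) with 1 by (field; lra).
  rewrite ln_1.
  destruct Rlt_dec as [H | _].
  - assert (HD := Delta_neg kappa rho gamma Hk Hr Hg H).
    assert (0 < sqrt (- Defs.Delta kappa rho gamma)) by (apply sqrt_lt_R0; lra).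
    rewrite Rmult_0_r, Rplus_0_l, tan_atan.
    pose proof (gamma_bar_ge_1 kappa rho Hk Hr).
    field; repeat split; lra.
  - destruct Req_EM_T as [_ | _]; [field; split; nra |].
    destruct Req_EM_T as [_ | _]; [unfold Rdiv; ring |].
    unfold Rpower; rewrite ln_1, Rmult_0_r, exp_0; unfold Rdiv; ring.
Qed.

(** * Solvability and uniqueness of the terminal value problems *)

Definition linear_ode_coef (T eps kappa rho gamma t k : R) : R :=
  gamma * (2 * (1 - rho) * k - kappa / (T + eps - t)).

Definition linear_ode_source (T eps kappa rho mu1 mu2 gamma t k : R) : R :=
  kappa * (1 - gamma) * (mu2 - rho * mu1) / ((1 - rho ^ 2) * (T + eps - t))
  - gamma * (mu1 - mu2) * k.

Lemma inv_time_bound (T eps t : R) : 0 < eps -> time_interval T t ->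
  Rabs (/ (T + eps - t)) <= / eps.
Proof.
  intros He Ht; unfold time_interval in Ht.
  rewrite Rabs_pos_eq.
  - apply Rinv_le_contravar; lra.
  - left; apply Rinv_0_lt_compat; lra.
Qed.

(** The nonlinearity is quadratic, so the difference of two solutions satisfies a linear equation
    whose coefficient contains [h + k]; this is bounded since both are continuous on a compact
    interval. *)
Lemma riccati_unique (T eps kappa rho gamma : R) (h k : R -> R) :
  0 <= T -> 0 < eps ->
  riccati T eps kappa rho gamma h -> riccati T eps kappa rho gamma k ->
  forall t, time_interval T t -> h t = k t.
Proof.
  intros HT He [[dh Hh] hT] [[dk Hk] kT].
  destruct (bounded_of_D_in T h dh HT (fun t Ht => proj1 (Hh t Ht))) as [B1 HB1].
  destruct (bounded_of_D_in T k dk HT (fun t Ht => proj1 (Hk t Ht))) as [B2 HB2].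
  set (M := Rabs (2 * (1 - rho) * gamma) * (B1 + B2)
            + Rabs (2 * gamma * kappa) * / eps).
  intros t Ht; apply Rminus_diag_uniq.
  refine (backward_gronwall T M (fun s => h s - k s) (fun s => dh s - dk s)
    HT _ _ _ t Ht).
  - intros s Hs; apply Dminus; [apply (Hh s Hs) | apply (Hk s Hs)].
  - intros s Hs; destruct (Hh s Hs) as [_ E1], (Hk s Hs) as [_ E2].
    replace (dh s - dk s)
      with (- (2 * (1 - rho) * gamma * (h s + k s)
               + - (2 * gamma * kappa * / (T + eps - s))) * (h s - k s)).
    2:{ replace (dh s) with (- - dh s) by ring; replace (dk s) with (- - dk s) by ring.
        rewrite E1, E2; unfold Rdiv; ring. }
    rewrite Rabs_mult, Rabs_Ropp.
    apply Rmult_le_compat_r; [apply Rabs_pos |].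
    eapply Rle_trans; [apply Rabs_triang |].
    rewrite Rabs_Ropp, !(Rabs_mult _ (_ + _)), (Rabs_mult _ (/ _)).
    apply Rplus_le_compat; apply Rmult_le_compat_l; try apply Rabs_pos.
    + eapply Rle_trans; [apply Rabs_triang |].
      apply Rplus_le_compat; auto.
    + apply inv_time_bound; assumption.
  - rewrite hT, kT; ring.
Qed.

Lemma linear_ode_unique (T eps kappa rho mu1 mu2 gamma : R) (h g k : R -> R) :
  0 <= T -> 0 < eps -> riccati T eps kappa rho gamma h ->
  linear_ode T eps kappa rho mu1 mu2 gamma h g ->
  linear_ode T eps kappa rho mu1 mu2 gamma h k ->
  forall t, time_interval T t -> g t = k t.
Proof.
  intros HT He [[dh Hh] _] [[dg Hg] gT] [[dk Hk] kT].
  destruct (bounded_of_D_in T h dh HT (fun t Ht => proj1 (Hh t Ht))) as [B HB].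
  set (M := Rabs gamma * (Rabs (2 * (1 - rho)) * B + Rabs kappa * / eps)).
  intros t Ht; apply Rminus_diag_uniq.
  refine (backward_gronwall T M (fun s => g s - k s) (fun s => dg s - dk s)
    HT _ _ _ t Ht).
  - intros s Hs; apply Dminus; [apply (Hg s Hs) | apply (Hk s Hs)].
  - intros s Hs; destruct (Hg s Hs) as [_ E1], (Hk s Hs) as [_ E2].
    replace (dg s - dk s)
      with (- (gamma * (2 * (1 - rho) * h s + - (kappa * / (T + eps - s)))) * (g s - k s))
      by (unfold Rdiv in *; lra).
    rewrite Rabs_mult, Rabs_Ropp.
    apply Rmult_le_compat_r; [apply Rabs_pos |].
    rewrite Rabs_mult; apply Rmult_le_compat_l; [apply Rabs_pos |].
    eapply Rle_trans; [apply Rabs_triang |].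
    rewrite Rabs_Ropp, (Rabs_mult _ (h s)), (Rabs_mult _ (/ _)).
    apply Rplus_le_compat; apply Rmult_le_compat_l; try apply Rabs_pos.
    + auto.
    + apply inv_time_bound; assumption.
  - rewrite gT, kT; ring.
Qed.

(** The coefficients are singular at [t = T + eps]. With time clamped inside them they are
    continuous on the line, so [g] is continuously differentiable everywhere and solves the original
    equation on [[0, T]]. *)
Lemma linear_ode_solvable (T eps kappa rho mu1 mu2 gamma : R) (h : R -> R) :
  0 <= T -> 0 < eps -> -1 < rho < 1 -> (forall t, continuous h t) ->
  exists g dg : R -> R,
    (forall t, is_derive g t (dg t)) /\ (forall t, continuous dg t) /\ g T = 0 /\
    forall t, time_interval T t ->
      dg t = linear_ode_source T eps kappa rho mu1 mu2 gamma t (h t)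
             - linear_ode_coef T eps kappa rho gamma t (h t) * g t.
Proof.
  intros HT He Hr Hh.
  assert (Hr2 : 0 < 1 - rho ^ 2) by nra.
  assert (Ha : forall t, continuous (fun s =>
    linear_ode_coef T eps kappa rho gamma (clamp T s) (h s)) t).
  { intros t; unfold linear_ode_coef.
    apply (continuous_scal_r gamma (fun s =>
      2 * (1 - rho) * h s - kappa / (T + eps - clamp T s))).
    apply (continuous_minus (fun s => 2 * (1 - rho) * h s)
      (fun s => kappa / (T + eps - clamp T s))).
    - apply (continuous_scal_r (2 * (1 - rho)) h); apply Hh.
    - apply (continuous_comp (clamp T) (fun s => kappa / (T + eps - s)));
        [apply continuous_clamp |].
      apply (ex_derive_continuous (fun s : R => kappa / (T + eps - s))).
      auto_derive; destruct (clamp_in T t HT); lra. }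
  assert (Hb : forall t, continuous (fun s =>
    linear_ode_source T eps kappa rho mu1 mu2 gamma (clamp T s) (h s)) t).
  { intros t; unfold linear_ode_source.
    apply (continuous_minus
      (fun s => kappa * (1 - gamma) * (mu2 - rho * mu1) / ((1 - rho ^ 2) * (T + eps - clamp T s)))
      (fun s => gamma * (mu1 - mu2) * h s)).
    - apply (continuous_comp (clamp T) (fun s =>
        kappa * (1 - gamma) * (mu2 - rho * mu1) / ((1 - rho ^ 2) * (T + eps - s))));
        [apply continuous_clamp |].
      apply (ex_derive_continuous (fun s : R =>
        kappa * (1 - gamma) * (mu2 - rho * mu1) / ((1 - rho ^ 2) * (T + eps - s)))).
      auto_derive; destruct (clamp_in T t HT).
      apply Rgt_not_eq, Rmult_lt_0_compat; lra.
    - apply (continuous_scal_r (gamma * (mu1 - mu2)) h); apply Hh. }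
  destruct (linear_ode_exists T _ _ Ha Hb) as [g [gT Hg]].
  exists g; eexists; split; [exact Hg | split; [| split; [exact gT |]]].
  - intros t; apply (continuous_minus
      (fun s => linear_ode_source T eps kappa rho mu1 mu2 gamma (clamp T s) (h s))
      (fun s => linear_ode_coef T eps kappa rho gamma (clamp T s) (h s) * g s));
      [apply Hb |].
    apply (continuous_mult (fun s => linear_ode_coef T eps kappa rho gamma (clamp T s) (h s)) g);
      [apply Ha |].
    apply (ex_derive_continuous g); eexists; apply Hg.
  - intros t Ht; simpl; rewrite (clamp_id T t Ht); reflexivity.
Qed.

Lemma is_derive_RInt_lower (f : R -> R) (b t : R) :
  (forall s, continuous f s) -> is_derive (fun s => RInt f s b) t (- f t).
Proof.
  intros H; apply (is_derive_RInt' f _ t b); [| apply H].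
  apply filter_forall; intros s; apply (RInt_correct (V := R_CompleteNormedModule)).
  apply (ex_RInt_continuous (V := R_CompleteNormedModule)); intros; apply H.
Qed.

(** The value prescribed for f', with [k] and [l] standing for the values of h and g in this
    order. *)
Definition f_rate (rho mu1 mu2 gamma k l : R) : R :=
  (1 - gamma) * (mu1 ^ 2 + mu2 ^ 2 - 2 * rho * mu1 * mu2) / (2 * (1 - rho ^ 2))
  - ((1 - rho) * gamma * l ^ 2 + gamma * (mu1 - mu2) * l + (1 - rho) * k).

Lemma continuous_f_integrand (rho mu1 mu2 gamma : R) (h g : R -> R) :
  (forall t, continuous h t) -> (forall t, continuous g t) ->
  forall t, continuous (f_integrand rho mu1 mu2 gamma h g) t.
Proof.
  intros Hh Hg t; unfold f_integrand.
  apply (continuous_plus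
    (fun u => (1 - rho) * gamma * g u ^ 2 + gamma * (mu1 - mu2) * g u)
    (fun u => (1 - rho) * h u)).
  - apply (continuous_comp g (fun y =>
      (1 - rho) * gamma * y ^ 2 + gamma * (mu1 - mu2) * y)); [apply Hg |].
    apply (ex_derive_continuous (fun y : R =>
      (1 - rho) * gamma * y ^ 2 + gamma * (mu1 - mu2) * y)).
    auto_derive; exact I.
  - apply (continuous_scal_r (1 - rho) h); apply Hh.
Qed.

Lemma f_coeff_derive (T rho mu1 mu2 gamma : R) (h g : R -> R) (t : R) :
  -1 < rho < 1 -> (forall t, continuous h t) -> (forall t, continuous g t) ->
  is_derive (f_coeff T rho mu1 mu2 gamma h g) t (f_rate rho mu1 mu2 gamma (h t) (g t)).
Proof.
  intros Hr Hh Hg.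
  assert (Hr2 : 0 < 1 - rho ^ 2) by nra.
  assert (D := is_derive_RInt_lower (f_integrand rho mu1 mu2 gamma h g) T t
    (continuous_f_integrand rho mu1 mu2 gamma h g Hh Hg)).
  unfold f_coeff.
  apply (is_derive_ext (fun s => RInt (f_integrand rho mu1 mu2 gamma h g) s T
    + (- (1 - gamma) * (mu1 ^ 2 + mu2 ^ 2 - 2 * rho * mu1 * mu2)
       / (2 * (1 - rho ^ 2))) * (T - s))).
  { intros s; simpl; field; nra. }
  replace (f_rate rho mu1 mu2 gamma (h t) (g t))
    with (- f_integrand rho mu1 mu2 gamma h g t +
      ((1 - gamma) * (mu1 ^ 2 + mu2 ^ 2 - 2 * rho * mu1 * mu2) / (2 * (1 - rho ^ 2))))
    by (unfold f_rate, f_integrand; field; nra).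
  apply (is_derive_plus (fun s => RInt (f_integrand rho mu1 mu2 gamma h g) s T)
    (fun s => (- (1 - gamma) * (mu1 ^ 2 + mu2 ^ 2 - 2 * rho * mu1 * mu2)
       / (2 * (1 - rho ^ 2))) * (T - s))); [exact D |].
  auto_derive; [exact I | field; nra].
Qed.

Lemma f_coeff_terminal (T rho mu1 mu2 gamma : R) (h g : R -> R) :
  f_coeff T rho mu1 mu2 gamma h g T = 0.
Proof.
  unfold f_coeff; rewrite RInt_point; unfold zero; simpl; unfold Rdiv; ring.
Qed.

(** * The HARA identity and the supremum over portfolios *)

Lemma is_derive_nonneg_of_increasing (f : R -> R) (x l : R) :
  locally x (fun y => x < y -> f x < f y) -> is_derive f x l -> 0 <= l.
Proof.
  intros [r Hf] D%is_derive_Reals; apply Rnot_lt_le; intros Hl.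
  destruct (D (- l) ltac:(lra)) as [e He].
  pose proof (cond_pos r); pose proof (cond_pos e).
  set (k := Rmin (r / 2) (e / 2)).
  assert (Hk : 0 < k) by (apply Rmin_pos; lra).
  assert (Hk1 : k <= r / 2) by apply Rmin_l.
  assert (Hk2 : k <= e / 2) by apply Rmin_r.
  assert (Hki : f x < f (x + k)).
  { apply Hf; [| lra].
    unfold ball; simpl; unfold AbsRing_ball, abs, minus, plus, opp; simpl.
    replace (x + k + - x) with k by ring; rewrite Rabs_pos_eq; lra. }
  specialize (He k ltac:(lra)); rewrite Rabs_pos_eq in He by lra.
  specialize (He ltac:(lra)).
  assert (0 < (f (x + k) - f x) / k) by (apply Rdiv_lt_0_compat; lra).
  revert He; apply Rle_not_lt; rewrite Rabs_pos_eq; lra.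
Qed.

Lemma open_wealth_domain (gamma xstar : R) : open (wealth_domain gamma xstar).
Proof.
  intros x [H | H].
  - apply filter_forall; intros y; left; exact H.
  - generalize (open_gt xstar x H); apply filter_imp; intros y Hy; right; exact Hy.
Qed.

Lemma hara_utility_facts (gamma xstar delta0 : R) (U : R -> R) :
  0 <= gamma -> gamma <> 1 -> 0 < delta0 -> hara_utility gamma xstar delta0 U ->
  forall x, wealth_domain gamma xstar x ->
    is_derive U x (Derive U x) /\
    is_derive (Derive U) x (Derive_n U 2 x) /\
    continuous (Derive_n U 2) x /\
    0 < Derive U x /\ Derive_n U 2 x < 0 /\ U x <> 0 /\
    Derive U x ^ 2 / Derive_n U 2 x = (1 - gamma) * U x.
Proof.
  intros Hg Hg1 Hd (Hs & Hi & _ & Hdelta & HU) x Hx.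
  assert (D1 : is_derive U x (Derive U x)) by (apply Derive_correct, (Hs 1%nat x Hx)).
  assert (D2 : is_derive (Derive U) x (Derive_n U 2 x))
    by (apply (Derive_correct (Derive U)), (Hs 2%nat x Hx)).
  assert (C2 : continuous (Derive_n U 2) x)
    by (apply (ex_derive_continuous (Derive_n U 2)), (Hs 3%nat x Hx)).
  destruct (Hdelta x Hx) as [N2 E2]; specialize (HU Hg1 x Hx).
  assert (Hdp : 0 < risk_tolerance gamma xstar delta0 x).
  { unfold risk_tolerance; destruct Req_EM_T; [exact Hd |].
    destruct Hx as [Hx | Hx]; [contradiction |].
    apply Rmult_lt_0_compat; lra. }
  assert (N1 : 0 <= Derive U x).
  { apply (is_derive_nonneg_of_increasing U x); [| exact D1].
    generalize (open_wealth_domain gamma xstar x Hx); apply filter_imp.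
    intros y Hy Hxy; apply Hi; assumption. }
  assert (P1 : 0 < Derive U x).
  (* A vanishing [U'] would make the risk tolerance zero. *)
  { destruct N1 as [N1 | N1]; [exact N1 | exfalso].
    rewrite <- N1 in E2; unfold Rdiv in E2; lra. }
  assert (P2 : Derive_n U 2 x < 0).
  { apply Rnot_le_lt; intros H.
    assert (0 < Derive U x / Derive_n U 2 x) by (apply Rdiv_lt_0_compat; lra).
    lra. }
  assert (EU : U x = Derive U x * (risk_tolerance gamma xstar delta0 x / (gamma - 1)))
    by (rewrite <- HU; field; lra).
  refine (conj D1 (conj D2 (conj C2 (conj P1 (conj P2 (conj _ _)))))).
  - rewrite EU; apply Rmult_integral_contrapositive_currified; [lra |].
    apply Rmult_integral_contrapositive_currified; [lra |].
    apply Rinv_neq_0_compat; lra.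
  - rewrite EU, <- E2; field; lra.
Qed.

Lemma sup_generator_quadratic (T eps kappa rho mu1 mu2 t z vx vxx vxz : R) :
  -1 < rho < 1 -> vxx < 0 ->
  let b1 := mu1 * vx + (1 - rho) * vxz in
  let b2 := (mu2 + kappa * z / (T - t + eps)) * vx - (1 - rho) * vxz in
  sup_generator T eps kappa rho mu1 mu2 t z vx vxx vxz
  = Finite (- (b1 ^ 2 + b2 ^ 2 - 2 * rho * b1 * b2) / (2 * (1 - rho ^ 2) * vxx)).
Proof.
  intros Hr Hv b1 b2; unfold sup_generator.
  assert (Hr2 : 0 < 1 - rho ^ 2) by nra.
  (* The maximiser solves the first-order condition [b + vxx * A q = 0], where [A] has unit
     diagonal, off-diagonal entries [rho] and determinant [1 - rho ^ 2]; [S] is the value attained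
     there. *)
  set (q1 := - (b1 - rho * b2) / ((1 - rho ^ 2) * vxx)).
  set (q2 := - (b2 - rho * b1) / ((1 - rho ^ 2) * vxx)).
  set (S := - (b1 ^ 2 + b2 ^ 2 - 2 * rho * b1 * b2) / (2 * (1 - rho ^ 2) * vxx)).
  assert (E : forall p1 p2,
    generator T eps kappa rho mu1 mu2 (p1, p2) t z vx vxx vxz
    = S + 1 / 2 * vxx * ((p1 - q1) ^ 2 + (p2 - q2) ^ 2 + 2 * rho * (p1 - q1) * (p2 - q2))).
  { intros p1 p2; unfold generator.
    transitivity (b1 * p1 + b2 * p2
      + 1 / 2 * (p1 ^ 2 + p2 ^ 2 + 2 * rho * p1 * p2) * vxx).
    - unfold b1, b2; ring.
    - unfold S, q1, q2; field; split; nra. }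
  apply is_lub_Rbar_unique; split.
  - intros y [[p1 p2] ->]; rewrite E; simpl.
    assert (0 <= (p1 - q1) ^ 2 + (p2 - q2) ^ 2 + 2 * rho * (p1 - q1) * (p2 - q2)).
    { replace ((p1 - q1) ^ 2 + (p2 - q2) ^ 2 + 2 * rho * (p1 - q1) * (p2 - q2))
        with (((p1 - q1) + rho * (p2 - q2)) ^ 2 + (1 - rho ^ 2) * (p2 - q2) ^ 2) by ring.
      apply Rplus_le_le_0_compat; [apply pow2_ge_0 |].
      apply Rmult_le_pos; [lra | apply pow2_ge_0]. }
    nra.
  - intros u Hu; apply (Hu S); exists (q1, q2); rewrite E; ring.
Qed.

(** With [v = U e^Q], [v_x = U' e^Q], ..., this is [v] times a quadratic
    polynomial in [z], whose coefficients are the three ordinary differential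
    equations. *)
Lemma hjb_residual (T eps kappa rho mu1 mu2 gamma t z u u1 u2 e F G H g h : R) :
  0 < T - t + eps -> -1 < rho < 1 -> u2 <> 0 -> 0 < e ->
  u1 ^ 2 / u2 = (1 - gamma) * u ->
  let vx := u1 * e in
  let vxx := u2 * e in
  let vxz := u1 * e * (g + h * z) in
  let b1 := mu1 * vx + (1 - rho) * vxz in
  let b2 := (mu2 + kappa * z / (T - t + eps)) * vx - (1 - rho) * vxz in
  u * e * (F + G * z + 1 / 2 * H * z ^ 2)
  + (mu1 - mu2 - kappa * z / (T - t + eps)) * (u * e * (g + h * z))
  + (1 - rho) * (u * e * (h + (g + h * z) ^ 2))
  + - (b1 ^ 2 + b2 ^ 2 - 2 * rho * b1 * b2) / (2 * (1 - rho ^ 2) * vxx)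
  = u * e * ((F - f_rate rho mu1 mu2 gamma h g)
             + (G - (linear_ode_source T eps kappa rho mu1 mu2 gamma t h
                     - linear_ode_coef T eps kappa rho gamma t h * g)) * z
             + 1 / 2 * (H - riccati_rate T eps kappa rho gamma t h) * z ^ 2).
Proof.
  intros Ht Hr Hu2 He Hu vx vxx vxz b1 b2.
  assert (Hr2 : 0 < 1 - rho ^ 2) by nra.
  (* These are [b1] and [b2] with the factor [u1 * e] removed, so that in the supremum [u1] and [u2]
     occur only through the HARA quotient [u1 ^ 2 / u2]. *)
  set (c1 := mu1 + (1 - rho) * (g + h * z)).
  set (c2 := mu2 + kappa * z / (T - t + eps) - (1 - rho) * (g + h * z)).
  replace (- (b1 ^ 2 + b2 ^ 2 - 2 * rho * b1 * b2) / (2 * (1 - rho ^ 2) * vxx))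
    with (- (u1 ^ 2 / u2) * e * (c1 ^ 2 + c2 ^ 2 - 2 * rho * c1 * c2) / (2 * (1 - rho ^ 2)))
    by (unfold b1, b2, c1, c2, vx, vxx, vxz; field; repeat split; lra).
  rewrite Hu; unfold c1, c2, f_rate, linear_ode_source, linear_ode_coef, riccati_rate.
  field; repeat split; lra.
Qed.

(** * Exponential-quadratic solutions *)

Lemma D_in_comp_is_derive (f d F d' : R -> R) (D : R -> Prop) (t l : R) :
  D_in f d D t -> is_derive F (f t) l -> d' t = d t * l ->
  D_in (fun s => F (f s)) d' D t.
Proof.
  intros Hf HF Hd'.
  assert (H := Dcomp D no_cond d (fun _ => l) f F t Hf
    (D_in_of_is_derive F (fun _ => l) no_cond (f t) HF)).
  apply (D_in_imp _ _ (Dgf D no_cond f) D) in H.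
  - unfold D_in in *; rewrite Hd'; exact H.
  - intros s Hs; split; [exact Hs | exact I].
Qed.

(** The solution and its six derivatives all have this form, with [A] one of [U], [U'], [U''] and a
    polynomial factor of degree at most two in [z]. *)
Lemma jointly_continuous_exp_quadratic (T : R) (D : R -> Prop)
    (A f g h a b c : R -> R) :
  (forall x, D x -> continuous A x) ->
  (forall t, continuous f t) -> (forall t, continuous g t) ->
  (forall t, continuous h t) -> (forall t, continuous a t) ->
  (forall t, continuous b t) -> (forall t, continuous c t) ->
  jointly_continuous T D (fun t x z =>
    exp_quadratic A f g h t x z * (a t + b t * z + c t * z ^ 2)).
Proof.
  intros HA Hf Hg Hh Ha Hb Hc p [_ Hx].
  (* Continuity at [p] in the whole space is proved, which implies continuity relative to the
     domain. *)
  apply (filterlim_filter_le_1 _ (filter_le_within _)).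
  set (pt := fun p : R * R * R => fst (fst p)).
  set (px := fun p : R * R * R => snd (fst p)).
  set (pz := fun p : R * R * R => snd p).
  assert (Kt : forall u : R -> R, (forall s, continuous u s) ->
    continuous (fun q => u (pt q)) p).
  { intros u Hu; apply (continuous_comp pt u); [| apply Hu].
    apply (continuous_comp fst fst); apply continuous_fst. }
  assert (Kz : continuous pz p) by apply continuous_snd.
  assert (Kz2 : continuous (fun q => pz q ^ 2) p).
  { apply (continuous_comp pz (fun y => y ^ 2)); [exact Kz |].
    apply (ex_derive_continuous (fun y : R => y ^ 2)); auto_derive; exact I. }
  assert (Kq : forall u v w : R -> R, (forall s, continuous u s) ->
    (forall s, continuous v s) -> (forall s, continuous w s) ->
    continuous (fun q => u (pt q) + v (pt q) * pz q + w (pt q) * pz q ^ 2) p).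
  { intros u v w Hu Hv Hw.
    apply (continuous_plus (fun q => u (pt q) + v (pt q) * pz q)
      (fun q => w (pt q) * pz q ^ 2)).
    - apply (continuous_plus (fun q => u (pt q)) (fun q => v (pt q) * pz q));
        [auto |].
      apply (continuous_mult (fun q => v (pt q)) pz); auto.
    - apply (continuous_mult (fun q => w (pt q)) (fun q => pz q ^ 2)); auto. }
  apply (continuous_mult
    (fun q => A (px q) * exp (f (pt q) + g (pt q) * pz q + 1 / 2 * h (pt q) * pz q ^ 2))
    (fun q => a (pt q) + b (pt q) * pz q + c (pt q) * pz q ^ 2)); [| auto].
  apply (continuous_mult (fun q => A (px q))
    (fun q => exp (f (pt q) + g (pt q) * pz q + 1 / 2 * h (pt q) * pz q ^ 2))).
  - apply (continuous_comp px A); [| apply HA, Hx].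
    apply (continuous_comp fst snd); [apply continuous_fst | apply continuous_snd].
  - apply (continuous_comp
      (fun q => f (pt q) + g (pt q) * pz q + 1 / 2 * h (pt q) * pz q ^ 2) exp);
      [| apply continuous_exp].
    apply (Kq f g (fun s => 1 / 2 * h s)); try assumption.
    intros s; apply (continuous_scal_r (1 / 2) h); apply Hh.
Qed.

Lemma jointly_continuous_ext (T : R) (D : R -> Prop) (phi psi : R -> R -> R -> R) :
  (forall t x z, phi t x z = psi t x z) ->
  jointly_continuous T D phi -> jointly_continuous T D psi.
Proof.
  intros E; unfold jointly_continuous.
  apply continuous_on_ext; intros p _; apply E.
Qed.

Lemma exp_quadratic_derive_x (U f g h : R -> R) (t x z l : R) :
  is_derive U x l ->
  is_derive (fun y => exp_quadratic U f g h t y z) x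
    (l * exp (f t + g t * z + 1 / 2 * h t * z ^ 2)).
Proof.
  intros HU; unfold exp_quadratic; auto_derive; [now exists l |].
  rewrite (is_derive_unique (fun u : R => U u) _ _ HU); simpl; ring.
Qed.

Lemma exp_quadratic_derive_z (U f g h : R -> R) (t x z : R) :
  is_derive (fun w => exp_quadratic U f g h t x w) z
    (exp_quadratic U f g h t x z * (g t + h t * z)).
Proof.
  unfold exp_quadratic; auto_derive; [exact I |].
  match goal with |- context [exp ?e] =>
    replace e with (f t + g t * z + 1 / 2 * h t * z ^ 2) by (simpl; ring) end.
  simpl; field.
Qed.

Lemma exp_quadratic_derive_zz (U f g h : R -> R) (t x z : R) :
  is_derive (fun w => exp_quadratic U f g h t x w * (g t + h t * w)) z
    (exp_quadratic U f g h t x z * (h t + (g t + h t * z) ^ 2)).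
Proof.
  assert (H := exp_quadratic_derive_z U f g h t x z).
  auto_derive; [eexists; exact H |].
  rewrite (is_derive_unique (fun w : R => exp_quadratic U f g h t x w) _ _ H); ring.
Qed.

Lemma exp_quadratic_time_derivative (U f g h : R -> R) (t x z F G H : R) :
  is_derive f t F -> is_derive g t G -> is_derive h t H ->
  is_derive (fun s => exp_quadratic U f g h s x z) t
    (exp_quadratic U f g h t x z * (F + G * z + 1 / 2 * H * z ^ 2)).
Proof.
  intros Hf Hg Hh; unfold exp_quadratic; auto_derive.
  - repeat split; first [now exists F | now exists G | now exists H | exact I].
  - rewrite (is_derive_unique (fun u : R => f u) _ _ Hf),
      (is_derive_unique (fun u : R => g u) _ _ Hg),
      (is_derive_unique (fun u : R => h u) _ _ Hh).
    match goal with |- context [exp ?e] =>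
      replace e with (f t + g t * z + 1 / 2 * h t * z ^ 2) by (simpl; ring) end.
    simpl; field.
Qed.

(** The two functions [h] and [k] are meant as the clamped and the unclamped coefficient: the time
    derivative is computed with [k] and transferred to [h] relative to [[0, T]], where both
    agree. *)
Lemma hjb_exp_quadratic (T eps kappa rho mu1 mu2 xstar gamma delta0 : R)
    (U f g h k df dg dh : R -> R) :
  0 < eps -> -1 < rho < 1 -> 0 <= gamma -> gamma <> 1 -> 0 < delta0 ->
  hara_utility gamma xstar delta0 U ->
  (forall t, continuous h t) -> (forall t, continuous dh t) ->
  (forall t, continuous dg t) -> (forall t, continuous df t) ->
  (forall t, is_derive f t (df t)) -> (forall t, is_derive g t (dg t)) ->
  (forall t, time_interval T t -> is_derive k t (dh t) /\ h t = k t) ->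
  f T = 0 -> g T = 0 -> h T = 0 ->
  (forall t, time_interval T t -> df t = f_rate rho mu1 mu2 gamma (h t) (g t)) ->
  (forall t, time_interval T t ->
     dg t = linear_ode_source T eps kappa rho mu1 mu2 gamma t (h t)
            - linear_ode_coef T eps kappa rho gamma t (h t) * g t) ->
  (forall t, time_interval T t -> dh t = riccati_rate T eps kappa rho gamma t (h t)) ->
  hjb_solution T eps kappa rho mu1 mu2 (wealth_domain gamma xstar) U
    (exp_quadratic U f g h).
Proof.
  intros He Hr Hg0 Hg1 Hd0 HU Ch Cdh Cdg Cdf Df Dg Dk fT gT hT Ef Eg Eh.
  assert (FU := hara_utility_facts gamma xstar delta0 U Hg0 Hg1 Hd0 HU).
  assert (Cf : forall t, continuous f t)
    by (intros t; apply (ex_derive_continuous f); eexists; apply Df).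
  assert (Cg : forall t, continuous g t)
    by (intros t; apply (ex_derive_continuous g); eexists; apply Dg).
  assert (C0 : forall x, wealth_domain gamma xstar x -> continuous U x)
    by (intros x Hx; apply (ex_derive_continuous U); eexists; exact (proj1 (FU x Hx))).
  assert (C1 : forall x, wealth_domain gamma xstar x -> continuous (Derive U) x)
    by (intros x Hx; apply (ex_derive_continuous (Derive U)); eexists;
        exact (proj1 (proj2 (FU x Hx)))).
  assert (C2 : forall x, wealth_domain gamma xstar x -> continuous (Derive_n U 2) x)
    by (intros x Hx; apply (FU x Hx)).
  assert (Cc : forall c t : R, continuous (fun _ : R => c) t)
    by (intros; apply continuous_const).
  assert (Chalf : forall t, continuous (fun s => 1 / 2 * dh s) t)
    by (intros t; apply (continuous_scal_r (1 / 2) dh); apply Cdh).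
  assert (Cm : forall u w : R -> R, (forall t, continuous u t) ->
    (forall t, continuous w t) -> forall t, continuous (fun s => u s * w s) t)
    by (intros u w Hu Hw t; apply (continuous_mult u w); auto).
  split.
  - exists (fun t x z => exp_quadratic U f g h t x z * (df t + dg t * z + 1 / 2 * dh t * z ^ 2)),
      (exp_quadratic (Derive U) f g h),
      (fun t x z => exp_quadratic U f g h t x z * (g t + h t * z)),
      (exp_quadratic (Derive_n U 2) f g h),
      (fun t x z => exp_quadratic (Derive U) f g h t x z * (g t + h t * z)),
      (fun t x z => exp_quadratic U f g h t x z * (h t + (g t + h t * z) ^ 2)).
    repeat match goal with |- _ /\ _ => split end.
    + eapply jointly_continuous_ext; [| apply (jointly_continuous_exp_quadratic T _
        U f g h (fun _ => 1) (fun _ => 0) (fun _ => 0)); auto].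
      intros t x z; simpl; ring.
    + apply (jointly_continuous_exp_quadratic T _ U f g h df dg (fun s => 1 / 2 * dh s)); auto.
    + eapply jointly_continuous_ext; [| apply (jointly_continuous_exp_quadratic T _
        (Derive U) f g h (fun _ => 1) (fun _ => 0) (fun _ => 0)); auto].
      intros t x z; simpl; ring.
    + eapply jointly_continuous_ext; [| apply (jointly_continuous_exp_quadratic T _
        U f g h g h (fun _ => 0)); auto].
      intros t x z; simpl; ring.
    + eapply jointly_continuous_ext; [| apply (jointly_continuous_exp_quadratic T _
        (Derive_n U 2) f g h (fun _ => 1) (fun _ => 0) (fun _ => 0)); auto].
      intros t x z; simpl; ring.
    + eapply jointly_continuous_ext; [| apply (jointly_continuous_exp_quadratic T _
        (Derive U) f g h g h (fun _ => 0)); auto].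
      intros t x z; simpl; ring.
    + eapply jointly_continuous_ext; [| apply (jointly_continuous_exp_quadratic T _
        U f g h (fun s => h s + g s * g s) (fun s => 2 * (g s * h s)) (fun s => h s * h s)); auto].
      * intros t x z; simpl; ring.
      * intros t; apply (continuous_plus h (fun s => g s * g s)); auto.
    + intros t x z Ht Hx.
      destruct (FU x Hx) as (D1 & D2 & _ & P1 & P2 & _ & EU).
      refine (conj _ (conj _ (conj _ (conj _ (conj _ (conj _ _)))))).
      * apply (D_in_congr _ (fun s => exp_quadratic U f g k s x z) _
          (fun s => exp_quadratic U f g k s x z * (df s + dg s * z + 1 / 2 * dh s * z ^ 2))).
        -- intros s Hs; unfold exp_quadratic; rewrite (proj2 (Dk s Hs)); reflexivity.
        -- exact Ht.
        -- unfold exp_quadratic; rewrite (proj2 (Dk t Ht)); reflexivity.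
        -- apply D_in_of_is_derive.
           apply (exp_quadratic_time_derivative U f g k t x z (df t) (dg t) (dh t));
             [apply Df | apply Dg | apply (Dk t Ht)].
      * apply exp_quadratic_derive_x; exact D1.
      * apply exp_quadratic_derive_z.
      * apply (exp_quadratic_derive_x (Derive U)); exact D2.
      * apply exp_quadratic_derive_z.
      * apply exp_quadratic_derive_zz.
      * assert (Htau : 0 < T - t + eps) by (destruct Ht; lra).
        assert (Hexp := exp_pos (f t + g t * z + 1 / 2 * h t * z ^ 2)).
        rewrite sup_generator_quadratic; [| exact Hr | unfold exp_quadratic; nra].
        simpl; f_equal; unfold exp_quadratic;
        assert (Hres := hjb_residual T eps kappa rho mu1 mu2 gamma t z (U x) (Derive U x)
          (Derive_n U 2 x) (exp (f t + g t * z + 1 / 2 * h t * z ^ 2)) (df t) (dg t) (dh t)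
          (g t) (h t) Htau Hr
          (Rlt_not_eq _ _ P2) Hexp EU).
        cbv zeta in Hres; unfold exp_quadratic in *.
        etransitivity; [exact Hres |].
        rewrite <- Ef, <- Eg, <- Eh by exact Ht; ring.
  - intros x z _; unfold exp_quadratic; rewrite fT, gT, hT.
    replace (0 + 0 * z + 1 / 2 * 0 * z ^ 2) with 0 by ring.
    rewrite exp_0; ring.
Qed.

(** The exponent is a polynomial in [z], so its values at [z = -1, 0, 1] recover
    the coefficients, and with them their differentiability in time. *)
Lemma hjb_exp_quadratic_inv (T eps kappa rho mu1 mu2 xstar gamma delta0 x : R)
    (U f g h : R -> R) :
  0 < eps -> -1 < rho < 1 -> 0 <= gamma -> gamma <> 1 -> 0 < delta0 ->
  hara_utility gamma xstar delta0 U -> wealth_domain gamma xstar x ->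
  hjb_solution T eps kappa rho mu1 mu2 (wealth_domain gamma xstar) U
    (exp_quadratic U f g h) ->
  riccati T eps kappa rho gamma h /\
  linear_ode T eps kappa rho mu1 mu2 gamma h g /\
  (forall t, time_interval T t ->
     D_in f (fun s => f_rate rho mu1 mu2 gamma (h s) (g s)) (time_interval T) t) /\
  f T = 0.
Proof.
  intros He Hr Hg0 Hg1 Hd0 HU Hx
    [(vt & vx & vz & vxx & vxz & vzz & _ & _ & _ & _ & _ & _ & _ & Hv) HvT].
  assert (FU := hara_utility_facts gamma xstar delta0 U Hg0 Hg1 Hd0 HU).
  destruct (FU x Hx) as (_ & _ & _ & _ & P2 & U0 & EU).
  set (Q := fun z t => f t + g t * z + 1 / 2 * h t * z ^ 2).
  set (r0 := fun t => f_rate rho mu1 mu2 gamma (h t) (g t)).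
  set (r1 := fun t => linear_ode_source T eps kappa rho mu1 mu2 gamma t (h t)
                      - linear_ode_coef T eps kappa rho gamma t (h t) * g t).
  set (r2 := fun t => riccati_rate T eps kappa rho gamma t (h t)).
  (* [Evx] is needed for all wealth levels, since [vxx] is the derivative of [vx] in wealth and the
     domain is open. *)
  assert (Evx : forall t y z, time_interval T t -> wealth_domain gamma xstar y ->
    vx t y z = exp_quadratic (Derive U) f g h t y z).
  { intros t y z Ht Hy; destruct (Hv t y z Ht Hy) as (_ & D & _).
    apply is_derive_unique in D; rewrite <- D.
    apply is_derive_unique, exp_quadratic_derive_x, (FU y Hy). }
  assert (Evz : forall t z, time_interval T t ->
    vz t x z = exp_quadratic U f g h t x z * (g t + h t * z)).
  { intros t z Ht; destruct (Hv t x z Ht Hx) as (_ & _ & D & _).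
    apply is_derive_unique in D; rewrite <- D.
    apply is_derive_unique, exp_quadratic_derive_z. }
  assert (Evt : forall t z, time_interval T t ->
    vt t x z / exp_quadratic U f g h t x z = r0 t + r1 t * z + 1 / 2 * r2 t * z ^ 2).
  { intros t z Ht; destruct (Hv t x z Ht Hx) as (_ & _ & _ & D1 & D2 & D3 & E).
    assert (Htau : 0 < T - t + eps) by (destruct Ht; lra).
    assert (Hexp := exp_pos (f t + g t * z + 1 / 2 * h t * z ^ 2)).
    apply (is_derive_ext_loc _ (fun y => exp_quadratic (Derive U) f g h t y z)) in D1.
    2:{ generalize (open_wealth_domain gamma xstar x Hx); apply filter_imp.
        intros y Hy; apply Evx; assumption. }
    apply is_derive_unique in D1.
    rewrite (is_derive_unique _ _ _
      (exp_quadratic_derive_x (Derive U) f g h t x z _ (proj1 (proj2 (FU x Hx))))) in D1.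
    apply (is_derive_ext _ (fun w => exp_quadratic (Derive U) f g h t x w)) in D2;
      [| intros w; apply Evx; assumption].
    apply is_derive_unique in D2.
    rewrite (is_derive_unique _ _ _
      (exp_quadratic_derive_z (Derive U) f g h t x z)) in D2.
    apply (is_derive_ext _ (fun w => exp_quadratic U f g h t x w * (g t + h t * w))) in D3;
      [| intros w; apply Evz; assumption].
    apply is_derive_unique in D3.
    rewrite (is_derive_unique _ _ _ (exp_quadratic_derive_zz U f g h t x z)) in D3.
    rewrite <- D1, <- D2, <- D3, (Evz t z Ht), (Evx t x z Ht Hx) in E.
    rewrite sup_generator_quadratic in E; [| exact Hr | nra].
    simpl in E; injection E as E.
    unfold exp_quadratic in *.
    set (e := exp (f t + g t * z + 1 / 2 * h t * z ^ 2)) in *.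
    (* Differentiability of [f], [g], [h] is not yet known, so the whole quotient [vt / v] takes the
       place of the constant coefficient and the other two are set to 0. *)
    assert (Hres := hjb_residual T eps kappa rho mu1 mu2 gamma t z (U x) (Derive U x)
      (Derive_n U 2 x) e (vt t x z / (U x * e)) 0 0
      (g t) (h t) Htau Hr
      (Rlt_not_eq _ _ P2) Hexp EU).
    cbv zeta in Hres.
    replace (U x * e * (vt t x z / (U x * e) + 0 * z + 1 / 2 * 0 * z ^ 2))
      with (vt t x z) in Hres by (field; split; lra).
    assert (Hz : U x * e <> 0) by (apply Rmult_integral_contrapositive_currified; lra).
    match type of E with ?a = 0 => match type of Hres with ?b = _ =>
      assert (Eab : b = a) by reflexivity end end.
    rewrite Eab, E in Hres; symmetry in Hres.
    apply Rmult_integral in Hres; destruct Hres as [Hres | Hres]; [contradiction |].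
    fold (r0 t) (r1 t) (r2 t) in Hres; unfold r0, r1, r2 in *; lra. }
  assert (DQ : forall z t, time_interval T t ->
    D_in (Q z) (fun t => r0 t + r1 t * z + 1 / 2 * r2 t * z ^ 2) (time_interval T) t).
  { intros z t Ht; destruct (Hv t x z Ht Hx) as [D _].
    assert (Hq : forall s, exp_quadratic U f g h s x z / U x = exp (Q z s))
      by (intros s; unfold exp_quadratic; fold (Q z s); field; exact U0).
    assert (Hne : exp_quadratic U f g h t x z <> 0).
    { apply Rmult_integral_contrapositive_currified; [exact U0 |].
      apply Rgt_not_eq, exp_pos. }
    (* The sign of [U] depends on [gamma]; dividing by [U x] first makes the argument of the
       logarithm positive. *)
    apply (D_in_congr _ (fun s => ln (exp_quadratic U f g h s x z / U x)) _
      (fun t => r0 t + r1 t * z + 1 / 2 * r2 t * z ^ 2)); [| exact Ht | reflexivity |].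
    - intros s _; rewrite Hq; apply ln_exp.
    - apply (D_in_comp_is_derive _ _ (fun y => ln (y / U x)) _ _ _
        (/ exp_quadratic U f g h t x z) D).
      + auto_derive.
        * change (0 < exp_quadratic U f g h t x z / U x).
          rewrite Hq; apply exp_pos.
        * field; split; assumption.
      + rewrite <- (Evt t z Ht); reflexivity. }
  assert (QT : forall z, Q z T = 0).
  { intros z; apply exp_inv; rewrite exp_0.
    specialize (HvT x z Hx); unfold exp_quadratic in HvT; fold (Q z T) in HvT.
    apply Rmult_eq_reg_l with (U x); [| exact U0].
    rewrite HvT; ring. }
  assert (Qh : forall t, Q 1 t + Q (-1) t - 2 * Q 0 t = h t) by (intros t; unfold Q; field).
  assert (Qg : forall t, 1 / 2 * (Q 1 t - Q (-1) t) = g t) by (intros t; unfold Q; field).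
  assert (Qf : forall t, Q 0 t = f t) by (intros t; unfold Q; field).
  repeat match goal with |- _ /\ _ => split end.
  - split.
    + exists r2; intros t Ht; split; [| unfold r2, riccati_rate; ring].
      eapply (D_in_congr _ (fun t => Q 1 t + Q (-1) t - 2 * Q 0 t));
        [intros s _; apply Qh | exact Ht | |
         apply Dminus; [apply Dadd; apply DQ; exact Ht | apply Dmult_const, DQ; exact Ht]].
      simpl; field.
    + rewrite <- Qh, !QT; ring.
  - split.
    + exists r1; intros t Ht; split.
      2:{ unfold r1, linear_ode_source, linear_ode_coef; ring. }
      eapply (D_in_congr _ (fun t => 1 / 2 * (Q 1 t - Q (-1) t)));
        [intros s _; apply Qg | exact Ht | |
         apply Dmult_const, Dminus; apply DQ; exact Ht].
      simpl; field.
    + rewrite <- Qg, !QT; ring.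
  - intros t Ht; eapply (D_in_congr _ (Q 0));
      [intros s _; apply Qf | exact Ht | | apply DQ; exact Ht].
    unfold r0; ring.
  - rewrite <- Qf; apply QT.
Qed.

(** * Existence and uniqueness of the exponential-quadratic solution *)

Theorem theorem3p3 (T eps kappa rho mu1 mu2 xstar gamma delta0 : R) (U : R -> R)
    (HT : 0 < T) (Heps : 0 < eps) (Hkappa : 0 < kappa) (Hrho : Rabs rho < 1)
    (Hxstar : 0 <= xstar) (Hgamma0 : 0 <= gamma) (Hgamma1 : gamma <> 1)
    (Hdelta0 : 0 < delta0) (HU : hara_utility gamma xstar delta0 U)
    (Hescape : Rbar_lt (Finite T) (escape_time eps kappa rho gamma)) :
  exists h g : R -> R,
    unique_on T (riccati T eps kappa rho gamma) h /\
    (forall t, time_interval T t -> h t = h_explicit T eps kappa rho gamma t) /\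
    unique_on T (linear_ode T eps kappa rho mu1 mu2 gamma h) g /\
    (forall t, time_interval T t ->
       ex_RInt (f_integrand rho mu1 mu2 gamma h g) t T) /\
    let D := wealth_domain gamma xstar in
    let f := f_coeff T rho mu1 mu2 gamma h g in
    let v := exp_quadratic U f g h in
    hjb_solution T eps kappa rho mu1 mu2 D U v /\
    (forall f' g' h' : R -> R,
       let v' := exp_quadratic U f' g' h' in
       hjb_solution T eps kappa rho mu1 mu2 D U v' ->
       forall t x z, time_interval T t -> D x -> v' t x z = v t x z).
Proof.
  assert (Hr : -1 < rho < 1) by (apply Rabs_lt_between; exact Hrho).
  assert (HT0 : 0 <= T) by lra.
  assert (Hr2 : 0 < 1 - rho ^ 2) by nra.
  assert (HiT : time_interval T T) by (unfold time_interval; lra).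
  set (k := h_explicit T eps kappa rho gamma).
  assert (Dk : forall t, time_interval T t ->
    is_derive k t (riccati_rate T eps kappa rho gamma t (k t)))
    by (intros t Ht; apply h_explicit_derive; assumption).
  (* Freezing the formula outside [[0, T]] removes its possible poles at negative times and the
     singularity at [T + eps]. *)
  set (h := fun t => k (clamp T t)).
  set (dh := fun t => riccati_rate T eps kappa rho gamma (clamp T t) (h t)).
  assert (Ehk : forall t, time_interval T t -> h t = k t)
    by (intros t Ht; unfold h; rewrite clamp_id by exact Ht; reflexivity).
  assert (Edh : forall t, time_interval T t ->
    dh t = riccati_rate T eps kappa rho gamma t (h t))
    by (intros t Ht; unfold dh; rewrite clamp_id by exact Ht; reflexivity).
  assert (Ch : forall t, continuous h t).
  { intros t; apply (continuous_comp (clamp T) k); [apply continuous_clamp |].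
    apply (ex_derive_continuous k); eexists; apply Dk, clamp_in, HT0. }
  assert (Cdh : forall t, continuous dh t).
  { intros t; apply (continuous_comp (clamp T)
      (fun s => riccati_rate T eps kappa rho gamma s (k s))); [apply continuous_clamp |].
    destruct (clamp_in T t HT0) as [H0 H1].
    apply (ex_derive_continuous (fun s => riccati_rate T eps kappa rho gamma s (k s))).
    unfold riccati_rate; auto_derive.
    repeat split; try lra; try (eexists; apply Dk; split; assumption).
    apply Rgt_not_eq; repeat apply Rmult_lt_0_compat; lra. }
  assert (hT : h T = 0)
    by (rewrite (Ehk T HiT); apply h_explicit_terminal; assumption).
  destruct (linear_ode_solvable T eps kappa rho mu1 mu2 gamma h HT0 Heps Hr Ch)
    as (g & dg & Dg & Cdg & gT & Eg).
  assert (Cg : forall t, continuous g t)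
    by (intros t; apply (ex_derive_continuous g); eexists; apply Dg).
  assert (CF := continuous_f_integrand rho mu1 mu2 gamma h g Ch Cg).
  assert (Rh : riccati T eps kappa rho gamma h).
  { split; [| exact hT].
    exists dh; intros t Ht; split.
    - apply (D_in_congr _ k h dh dh); [intros s Hs; symmetry; auto | exact Ht | reflexivity |].
      apply D_in_of_is_derive; rewrite (Edh t Ht), (Ehk t Ht); auto.
    - rewrite (Edh t Ht); unfold riccati_rate; ring. }
  assert (Lg : linear_ode T eps kappa rho mu1 mu2 gamma h g).
  { split; [| exact gT].
    exists dg; intros t Ht; split; [apply D_in_of_is_derive, Dg |].
    rewrite (Eg t Ht); unfold linear_ode_source, linear_ode_coef; ring. }
  exists h, g; split; [| split; [| split; [| split]]].
  - split; [exact Rh |].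
    intros h' Rh'; exact (riccati_unique T eps kappa rho gamma h' h HT0 Heps Rh' Rh).
  - exact Ehk.
  - split; [exact Lg |].
    intros g' Lg'.
    exact (linear_ode_unique T eps kappa rho mu1 mu2 gamma h g' g HT0 Heps Rh Lg' Lg).
  - intros t _; apply (ex_RInt_continuous (V := R_CompleteNormedModule)).
    intros s _; apply CF.
  - intros D f v.
    assert (Df : forall t, is_derive f t (f_rate rho mu1 mu2 gamma (h t) (g t)))
      by (intros t; apply f_coeff_derive; assumption).
    assert (fT : f T = 0) by apply f_coeff_terminal.
    split.
    + apply (hjb_exp_quadratic T eps kappa rho mu1 mu2 xstar gamma delta0 U f g h k
        (fun t => f_rate rho mu1 mu2 gamma (h t) (g t)) dg dh); try assumption.
      * intros t.
        apply (continuous_minus (fun _ => (1 - gamma)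
          * (mu1 ^ 2 + mu2 ^ 2 - 2 * rho * mu1 * mu2) / (2 * (1 - rho ^ 2)))
          (f_integrand rho mu1 mu2 gamma h g)); [apply continuous_const | apply CF].
      * intros t Ht; split; [rewrite (Edh t Ht), (Ehk t Ht) | ]; auto.
      * reflexivity.
    + intros f' g' h' v' Hv' t x z Ht Hx.
      destruct (hjb_exp_quadratic_inv T eps kappa rho mu1 mu2 xstar gamma delta0 x
        U f' g' h' Heps Hr Hgamma0 Hgamma1 Hdelta0 HU Hx Hv') as (Rh' & Lg' & Df' & f'T).
      assert (Eh' := riccati_unique T eps kappa rho gamma h' h HT0 Heps Rh' Rh).
      assert (Lg'' : linear_ode T eps kappa rho mu1 mu2 gamma h g').
      { destruct Lg' as [[dg' Hg'] g'T]; split; [| exact g'T].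
        exists dg'; intros s Hs; rewrite <- (Eh' s Hs); exact (Hg' s Hs). }
      assert (Eg' := linear_ode_unique T eps kappa rho mu1 mu2 gamma h g' g
        HT0 Heps Rh Lg'' Lg).
      assert (Ef' : forall s, time_interval T s -> f' s - f s = 0).
      (* Once h and g agree the two rates coincide, so the difference has zero derivative and the
         Gronwall constant is 0. *)
      { refine (backward_gronwall T 0 (fun s => f' s - f s)
          (fun s => f_rate rho mu1 mu2 gamma (h' s) (g' s)
                    - f_rate rho mu1 mu2 gamma (h s) (g s)) HT0 _ _ _).
        - intros s Hs; apply Dminus; [exact (Df' s Hs) |].
          apply D_in_of_is_derive, Df.
        - intros s Hs; rewrite (Eh' s Hs), (Eg' s Hs), Rminus_diag, Rabs_R0; lra.
        - rewrite f'T, fT; ring. }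
      unfold v', v, exp_quadratic.
      rewrite (Eh' t Ht), (Eg' t Ht), (Rminus_diag_uniq _ _ (Ef' t Ht)); reflexivity.
Qed.
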